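(* Let $G$ be a finite group and let $n,m>0$. Via the isomorphisms $\widehat{H}^{-k-1}(G,\mathbb{Z})\cong H_k(G,\mathbb{Z})$ ($k\ge 1$) described in the context, the cup product in negative Tate cohomology gives a product $$H_{n}(G,\mathbb{Z})\otimes H_{m}(G,\mathbb{Z})\rightarrow H_{n+m+1}(G,\mathbb{Z}).$$ Each homology class in $H_n(G,\mathbb{Z})$ is represented by a $G$-invariant singular cycle $z\in C_n(EG)$. If $a\in H_n(G,\mathbb{Z})$ and $b\in H_m(G,\mathbb{Z})$ are represented by $G$-invariant cycles $z\in C_n(EG)$ and $w\in C_m(EG)$, then the product of $a$ and $b$ is represented by the join $z\ast w\in C_{n+m+1}(EG\ast EG)$, which is a $G$-invariant cycle.
   Context: $G$ is a finite group; modules are left modules; $\mathbb{Z}$ is the trivial $\mathbb{Z}[G]$-module. $\underline{Hom}_{\mathbb{Z}[G]}(M,N)$ is the quotient of $Hom_{\mathbb{Z}[G]}(M,N)$ by the subgroup of maps factoring through a projective module. For a projective resolution $\cdots\to P_1\to P_0\to M$ put $P_{-1}=M$ and $\Omega^k M=\Omega^k_P M=\ker(P_{k-1}\to P_{k-2})$ for $k\ge1$; different resolutions give canonically isomorphic groups $\underline{Hom}_{\mathbb{Z}[G]}(\Omega^kM,\Omega^lN)$, the identifications being induced by chain maps of resolutions lifting the identity. For $n>0$, $\widehat{H}^{-n}(G,\mathbb{Z})=\underline{Hom}_{\mathbb{Z}[G]}(\mathbb{Z},\Omega^{n}\mathbb{Z})$. Cup product: for $[f]\in \underline{Hom}_{\mathbb{Z}[G]}(\mathbb{Z},\Omega^{n}\mathbb{Z})$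 and $[g]\in\underline{Hom}_{\mathbb{Z}[G]}(\mathbb{Z},\Omega^{m}\mathbb{Z})\cong\underline{Hom}_{\mathbb{Z}[G]}(\Omega^{n}\mathbb{Z},\Omega^{n+m}\mathbb{Z})$ (the isomorphism is the one given by applying the functor $\Omega^n$), $[f]\cup[g]=[g\circ f]\in\underline{Hom}_{\mathbb{Z}[G]}(\mathbb{Z},\Omega^{n+m}\mathbb{Z})$. Isomorphism with homology: let $N=\sum_{g\in G}g\in\mathbb{Z}[G]$. For a projective resolution $P$ of $\mathbb{Z}$ and $k\geq1$, the isomorphism $\widehat{H}^{-k-1}(G,\mathbb{Z})\to H_k(G,\mathbb{Z})=H_k(P\otimes_{\mathbb{Z}[G]}\mathbb{Z})$ sends the class of $f:\mathbb{Z}\to\Omega_P^{k+1}\mathbb{Z}\subset P_k$ to the class of $y\otimes 1$, where $y\in P_k$ is any element with $f(1)=Ny$. A $G$-invariant cycle $z\in P_k$ is said to represent a class in $H_k(G,\mathbb{Z})$ if that class corresponds in this way to the map $\mathbb{Z}\to\Omega^{k+1}_P\mathbb{Z}$, $1\mapsto z$. $EG$ is a contractible $G$-CW complex with free $G$-action and $C_*(X)$ is the augmented singular chain complex (with $C_{-1}(X)=\mathbb{Z}$). The join $EG\ast EG$ has the free $G$-action $g(x,y,t)=(gx,gy,t)$ and is contractible, so both $C_*(EG)$ and $C_*(EG\ast EG)$ are projective resolutions of $\mathbb{Z}$ over $\mathbb{Z}[G]$. For singular simplices $\sigma:\Delta^n\to A$ and $\tau:\Delta^m\to B$ ($n,m\ge0$),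 $\sigma\ast\tau:\Delta^{n+m+1}=\Delta^n\ast\Delta^m\to A\ast B$ is the join of the two maps (vertices of $\Delta^n$ first), and this is extended bilinearly to chains. *)

(* Defs.v *)
From HB Require Import structures.
From mathcomp Require Import all_boot all_order all_algebra all_fingroup.
From mathcomp Require Import ring_quotient generic_quotient.
From mathcomp Require Import all_classical all_reals all_analysis.
From mathcomp Require Import zify.
From mathcomp.multinomials Require Import freeg.
Set Implicit Arguments.
Unset Strict Implicit.
Unset Printing Implicit Defensive.
Import Order.TTheory GRing.Theory Num.Theory numFieldNormedType.Exports.
Local Open Scope classical_set_scope.
Local Open Scope ring_scope.
Local Open Scope quotient_scope.

Lemma freeg_ext (K : choiceType) (V : zmodType) (f g : {freeg K / int} -> V) :
  zmod_morphism f -> zmod_morphism g ->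
  (forall x, f << x >> = g << x >>) -> f =1 g.
Proof.
move=> fB gB fg.
pose F := GRing.isZmodMorphism.Build _ _ f fB.
pose G := GRing.isZmodMorphism.Build _ _ g gB.
pose f' : {additive {freeg K / int} -> V} := HB.pack f F.
pose g' : {additive {freeg K / int} -> V} := HB.pack g G.
have e k x : << k *g x >> = << x >> *~ k :> {freeg K / int}.
  by rewrite freeg_mulz intz.
suff: f' =1 g' by [].
elim/freeg_ind_dom0 => [|k x D _ _ IH]; first by rewrite !raddf0.
by rewrite !raddfD IH e !raddfMz /= fg.
Qed.

(* {freeg K / int} is the free abelian group on K; free_map f is the map it
   induces on generators. *)
Definition free_map (K L : choiceType) (f : K -> L) :
    {freeg K / int} -> {freeg L / int} :=
  fglift (fun x => << f x >>).

Lemma free_map_is_zmod_morphism (K L : choiceType) (f : K -> L) :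
  zmod_morphism (free_map f).
Proof. exact: lift_is_additive. Qed.

HB.instance Definition _ (K L : choiceType) (f : K -> L) :=
  GRing.isZmodMorphism.Build _ _ (free_map f) (free_map_is_zmod_morphism f).

Lemma free_mapU (K L : choiceType) (f : K -> L) k x :
  free_map f << k *g x >> = << k *g f x >>.
Proof.
by rewrite /free_map liftU; apply/eqP/freeg_eqP => z; rewrite coeffZ !coeffU mul1r.
Qed.

Lemma free_map_id (K : choiceType) : free_map (@id K) =1 id.
Proof. by apply: freeg_ext => [||x]; [exact: raddfB | move=> ? ? | rewrite free_mapU]. Qed.

Lemma free_map_comp (K L M : choiceType) (f : K -> L) (g : L -> M) :
  free_map (g \o f) =1 free_map g \o free_map f.
Proof.
apply: freeg_ext => [||x]; [exact: raddfB | | by rewrite /= !free_mapU].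
by move=> x y /=; rewrite !raddfB.
Qed.

Section Subgroups.
Variable V : zmodType.

(* The subgroup generated by A. *)
Definition zspan (A : set V) : set V :=
  smallest [set S | S 0 /\ forall x y, S x -> S y -> S (x - y)] A.

Definition zspanb (A : set V) : {pred V} := fun x => `[< zspan A x >].

Lemma zspanb_zmod A : zmod_closed (zspanb A).
Proof.
split => [|x y]; rewrite !unfold_in; first by apply/asboolP => S [[]].
move=> /asboolP xA /asboolP yA; apply/asboolP => S SA.
by have [[_ SB] _] := SA; apply: SB; [exact: xA | exact: yA].
Qed.
HB.instance Definition _ A := GRing.isZmodClosed.Build V (zspanb A) (zspanb_zmod A).

End Subgroups.

Section Homology.
Variables (A B C : zmodType) (f : {additive A -> B}) (g : {additive B -> C}).

Definition zker_pred : {pred B} := fun x => g x == 0.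
Lemma zker_closed : zmod_closed zker_pred.
Proof.
split => [|x y]; rewrite !unfold_in ?raddf0 // raddfB => /eqP-> /eqP->.
by rewrite subrr.
Qed.
HB.instance Definition _ := GRing.isZmodClosed.Build B zker_pred zker_closed.

Definition zker : Type := {x | zker_pred x}.
HB.instance Definition _ := [isSub of zker for sval].
HB.instance Definition _ := [Choice of zker by <:].
HB.instance Definition _ := [SubChoice_isSubZmodule of zker by <:].

Definition bound_pred : {pred zker} := fun x => `[< exists y, f y = val x >].
Lemma bound_closed : zmod_closed bound_pred.
Proof.
split => [|x y]; rewrite !unfold_in.
  by apply/asboolP; exists 0; rewrite !raddf0.
move=> /asboolP[x' fx] /asboolP[y' fy]; apply/asboolP; exists (x' - y').
by rewrite !raddfB /= fx fy.
Qed.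
HB.instance Definition _ := GRing.isZmodClosed.Build zker bound_pred bound_closed.

(* ker g / im f, the image of f being cut down to ker g (the same thing as soon
   as g \o f = 0). *)
Definition homology : zmodType := Quotient.quot bound_pred.
Definition homology_class (x : zker) : homology := \pi_homology x.
End Homology.

Section GroupRing.
Variable gT : finGroupType.

(* Z[gT], i.e. functions gT -> Z under convolution; the ring structure is put on
   an alias because {ffun gT -> int} already carries pointwise operations. *)
Definition groupring : Type := {ffun gT -> int}.
HB.instance Definition _ := GRing.Zmodule.copy groupring {ffun gT -> int}.

Definition gr_elt (g : gT) : groupring := [ffun h => (h == g)%:R].

Lemma groupring_mulrzE (a : groupring) (k : int) h : (a *~ k) h = a h *~ k.
Proof.
case: k => k; rewrite ?NegzE ?mulrNz -!pmulrn ?ffunE; last congr (- _).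
  by elim: k => [|k IH]; rewrite ?mulr0n ?ffunE // !mulrS ffunE IH.
by elim: k => [|k IH]; rewrite ?mulr1n // [in LHS]mulrS [in RHS]mulrS ffunE IH.
Qed.

Lemma groupringE (a : groupring) : a = \sum_g gr_elt g *~ a g.
Proof.
apply/ffunP => h; rewrite sum_ffunE (bigD1 h) //= big1 => [|g gh].
  by rewrite addr0 groupring_mulrzE ffunE eqxx intz.
by rewrite groupring_mulrzE ffunE eq_sym (negPf gh) mul0rz.
Qed.

Definition gr_mul (a b : groupring) : groupring :=
  [ffun g => \sum_h a h * b (h^-1 * g)%g].

Fact gr_mulA : associative gr_mul.
Proof.
move=> a b c; apply/ffunP => g; rewrite !ffunE.
under eq_bigr do rewrite ffunE mulr_sumr.
under [RHS]eq_bigr do rewrite ffunE mulr_suml.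
rewrite [RHS]exchange_big; apply: eq_bigr => k _ /=.
rewrite [RHS](reindex_inj (mulgI k)); apply: eq_bigr => l _ /=.
by rewrite mulrA !mulgA mulVg mul1g invMg.
Qed.

Fact gr_mul1 : left_id (gr_elt 1) gr_mul.
Proof.
move=> a; apply/ffunP => g; rewrite ffunE (bigD1 1%g) //= big1 => [|h h1].
  by rewrite ffunE eqxx mul1r invg1 mul1g addr0.
by rewrite ffunE (negPf h1) mul0r.
Qed.

Fact gr_mulr1 : right_id (gr_elt 1) gr_mul.
Proof.
move=> a; apply/ffunP => g; rewrite ffunE (bigD1 g) //= big1 => [|h h1].
  by rewrite ffunE mulVg eqxx mulr1 addr0.
rewrite ffunE -eq_mulVg1 (negPf h1) mulr0 //.
Qed.

Fact gr_mulDl : left_distributive gr_mul +%R.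
Proof.
move=> a b c; apply/ffunP => g; rewrite !ffunE -big_split.
by apply: eq_bigr => h _; rewrite ffunE mulrDl.
Qed.

Fact gr_mulDr : right_distributive gr_mul +%R.
Proof.
move=> a b c; apply/ffunP => g; rewrite !ffunE -big_split.
by apply: eq_bigr => h _; rewrite ffunE mulrDr.
Qed.

Fact gr1_neq0 : gr_elt 1 != 0 :> groupring.
Proof. by apply/eqP => /ffunP/(_ 1%g); rewrite !ffunE eqxx. Qed.

HB.instance Definition _ := GRing.Zmodule_isNzRing.Build groupring
  gr_mulA gr_mul1 gr_mulr1 gr_mulDl gr_mulDr gr1_neq0.

(* The norm element N, the sum of all g. *)
Definition gr_norm : groupring := \sum_g gr_elt g.

(* The anti-automorphism g |-> g^-1, which turns left modules into right ones. *)
Definition gr_antipode (a : groupring) : groupring := [ffun g => a g^-1%g].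

(* Z[gT]-module structure from an additive left action of gT. *)
Section Action.
Variables (V : zmodType) (act : gT -> V -> V).
Hypothesis act1 : act 1%g =1 id.
Hypothesis actM : forall g h x, act (g * h)%g x = act g (act h x).
Hypothesis actB : forall g, zmod_morphism (act g).

Definition gr_scale (a : groupring) (x : V) : V := \sum_g act g x *~ a g.

Let actA g : {additive V -> V} :=
  HB.pack (act g) (GRing.isZmodMorphism.Build V V (act g) (actB g)).

Lemma gr_scaleA a b x : gr_scale a (gr_scale b x) = gr_scale (a * b) x.
Proof.
rewrite /gr_scale.
have eA g y : act g y = actA g y by [].
under eq_bigr => g _ do rewrite eA raddf_sum mulrz_suml.
under [RHS]eq_bigr => g _ do rewrite ffunE mulrz_sumr.
rewrite [RHS]exchange_big; apply: eq_bigr => g _ /=.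
rewrite [RHS](reindex_inj (mulgI g)); apply: eq_bigr => h _.
by rewrite eA (raddfMz (actA g)) /= mulgA mulVg mul1g actM -mulrzA mulrC.
Qed.

Lemma gr_scale1 : left_id 1 gr_scale.
Proof.
move=> x; rewrite /gr_scale (bigD1 1%g) //= big1 => [|g g1].
  by rewrite ffunE eqxx act1 addr0.
by rewrite ffunE (negPf g1) mulr0z.
Qed.

Lemma gr_scaleDr : right_distributive gr_scale +%R.
Proof.
move=> a x y; rewrite /gr_scale -big_split; apply: eq_bigr => g _ /=.
have eA z : act g z = actA g z by []; by rewrite -mulrzDl eA (raddfD (actA g)).
Qed.

Lemma gr_scaleDl x : {morph gr_scale^~ x : a b / a + b}.
Proof.
move=> a b; rewrite /gr_scale -big_split; apply: eq_bigr => g _ /=.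
by rewrite ffunE mulrzDr.
Qed.

Lemma gr_scaleE g x : gr_scale (gr_elt g) x = act g x.
Proof.
rewrite /gr_scale (bigD1 g) //= big1 => [|h hg].
  by rewrite ffunE eqxx addr0.
by rewrite ffunE (negPf hg) mulr0z.
Qed.
End Action.

(* The trivial module Z. *)
Definition trivZ (_ : finGroupType) : Type := int.
HB.instance Definition _ G := GRing.Zmodule.copy (trivZ G) int.
Definition one_trivZ G : trivZ G := 1%Z.
Let triv_act (g : gT) (x : trivZ gT) := x.
HB.instance Definition _ := GRing.Zmodule_isLmodule.Build groupring (trivZ gT)
  (@gr_scaleA _ triv_act (fun _ _ _ => erefl) (fun _ _ _ => erefl))
  (@gr_scale1 _ triv_act (fun=> erefl))
  (@gr_scaleDr _ triv_act (fun _ _ _ => erefl))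
  (@gr_scaleDl _ triv_act).

Lemma trivZ_actE g (x : trivZ gT) : gr_elt g *: x = x.
Proof. exact: gr_scaleE. Qed.

End GroupRing.

Section Tensor.
Variable gT : finGroupType.
Local Notation ZG := (groupring gT).

(* M (x)_{Z[G]} N for left modules M and N, where M is a right module through
   x . a = gr_antipode a *: x. *)
Definition tensor_rel (M N : lmodType ZG) : set {freeg (M * N)%type / int} :=
  [set t | [\/ exists x x' y, t = << (x + x', y) >> - << (x, y) >> - << (x', y) >>,
             exists x y y', t = << (x, y + y') >> - << (x, y) >> - << (x, y') >>
           | exists (a : ZG) x y,
               t = << (gr_antipode a *: x, y) >> - << (x, a *: y) >>]].

Definition tensor (M N : lmodType ZG) : zmodType :=
  Quotient.quot (zspanb (@tensor_rel M N)).

Definition tens (M N : lmodType ZG) (x : M) (y : N) : tensor M N :=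
  \pi_(tensor M N) << (x, y) >>.

Section Map.
Variables (M M' N : lmodType ZG) (f : {linear M -> M'}).
Local Notation F := (@free_map (M * N)%type (M' * N)%type (fun p => (f p.1, p.2))).

Lemma tensor_rel_map t : zspanb (@tensor_rel M N) t -> zspanb (@tensor_rel M' N) (F t).
Proof.
move/asboolP => st; apply/asboolP => S [[S0 SB] Sr].
apply: (st (F @^-1` S)); split=> /=; first by split; [rewrite raddf0 | move=> x y Sx Sy; rewrite raddfB; exact: SB].
move=> u ru; apply: Sr; case: ru => [[x [x' [y ->]]]|[x [y [y' ->]]]|[a [x [y ->]]]];
  rewrite !raddfB /= !free_mapU /= ?raddfD ?linearZ /=.
- by apply: Or31; exists (f x), (f x'), y.
- by apply: Or32; exists (f x), y, y'.
- by apply: Or33; exists a, (f x), y.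
Qed.

Definition tens_map (t : tensor M N) : tensor M' N := \pi_(tensor M' N) (F (repr t)).

Lemma tens_map_pi t : tens_map (\pi_(tensor M N) t) = \pi_(tensor M' N) (F t).
Proof.
apply/eqP; rewrite /tens_map -Quotient.idealrBE -raddfB; apply: tensor_rel_map.
by rewrite -[zspanb _ _]/(_ \in zspanb _) Quotient.idealrBE reprK.
Qed.

Lemma tens_mapE x y : tens_map (tens x y) = tens (f x) y.
Proof. by rewrite /tens tens_map_pi free_mapU. Qed.

Lemma tens_map_is_zmod_morphism : zmod_morphism tens_map.
Proof.
move=> x y; rewrite -[x]reprK -[y]reprK -raddfB !tens_map_pi -raddfB.
by rewrite -raddfB.
Qed.
HB.instance Definition _ := GRing.isZmodMorphism.Build _ _ tens_map tens_map_is_zmod_morphism.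
End Map.
End Tensor.
Arguments tens_map {gT M M'} N f t.

Section StableHom.
Variable R : nzRingType.

HB.instance Definition _ (M N : lmodType R) := gen_eqMixin {linear M -> N}.
HB.instance Definition _ (M N : lmodType R) := gen_choiceMixin {linear M -> N}.

Section Hom.
Variables M N : lmodType R.
Implicit Types f g : {linear M -> N}.

Lemma linear_ext f g : f =1 g -> f = g.
Proof.
case: f g => f [[f1] [f2]] [g [[g1] [g2]]] /= /funext fg; subst g.
by rewrite (Prop_irrelevance f1 g1) (Prop_irrelevance f2 g2).
Qed.

Definition hom_add f g : {linear M -> N} := f \+ g.
Definition hom_opp f : {linear M -> N} := \- f.
Definition hom_zero : {linear M -> N} := \0.

Fact hom_addA : associative hom_add.
Proof. by move=> f g h; apply: linear_ext => x /=; rewrite addrA. Qed.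
Fact hom_addC : commutative hom_add.
Proof. by move=> f g; apply: linear_ext => x /=; rewrite addrC. Qed.
Fact hom_add0 : left_id hom_zero hom_add.
Proof. by move=> f; apply: linear_ext => x /=; rewrite add0r. Qed.
Fact hom_addN : left_inverse hom_zero hom_opp hom_add.
Proof. by move=> f; apply: linear_ext => x /=; rewrite addNr. Qed.
HB.instance Definition _ := GRing.isZmodule.Build {linear M -> N}
  hom_addA hom_addC hom_add0 hom_addN.
End Hom.


Definition projective (P : lmodType R) : Prop :=
  forall (A B : lmodType R) (p : {linear A -> B}) (f : {linear P -> B}),
    (forall b, exists a, p a = b) ->
    exists f' : {linear P -> A}, forall x, p (f' x) = f x.

Section Stable.
Variables M N : lmodType R.

(* Maps that factor through a projective module. *)
Definition factors_proj : {pred {linear M -> N}} :=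
  fun f => `[< exists (P : lmodType R) (i : {linear M -> P}) (p : {linear P -> N}),
                 projective P /\ forall x, f x = p (i x) >].

Lemma factors_proj_zmod : zmod_closed factors_proj.
Proof.
split => [|f g]; rewrite !unfold_in.
  apply/asboolP; exists 'rV[R]_0, \0, \0; split => // A B p f _.
  exists \0 => x /=.
  by rewrite (_ : x = 0) ?raddf0 //; apply/rowP => -[].
move=> /asboolP[P [i [p [prP fE]]]] /asboolP[Q [j [q [prQ gE]]]].
apply/asboolP.
have iL : linear (fun x => (i x, j x)) by move=> a x y /=; rewrite !linearP.
have pL : linear (fun x => p x.1 - q x.2).
  by move=> a x y /=; rewrite (linearP p) (linearP q) opprD scalerBr addrACA.
pose ij : {linear M -> (P * Q)%type} := HB.pack (fun x => (i x, j x))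
  (GRing.isLinear.Build R M (P * Q)%type _ _ iL).
pose pq : {linear (P * Q)%type -> N} := HB.pack (fun x : P * Q => p x.1 - q x.2)
  (GRing.isLinear.Build R (P * Q)%type N _ _ pL).
exists (P * Q)%type, ij, pq; split => [A B r h rS|x]; last by rewrite /= fE gE.
have h1L : linear (fun x => h (x, 0)).
  by move=> a x y; rewrite -linearP; congr (h _); congr (_, _); rewrite /= scaler0 addr0.
have h2L : linear (fun x => h (0, x)).
  by move=> a x y; rewrite -linearP; congr (h _); congr (_, _); rewrite /= scaler0 addr0.
pose h1 : {linear P -> B} := HB.pack (fun x => h (x, 0))
  (GRing.isLinear.Build R P B _ _ h1L).
pose h2 : {linear Q -> B} := HB.pack (fun x => h (0, x))
  (GRing.isLinear.Build R Q B _ _ h2L).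
have [k1 k1E] := prP _ _ _ h1 rS; have [k2 k2E] := prQ _ _ _ h2 rS.
have kL : linear (fun x : P * Q => k1 x.1 + k2 x.2).
  by move=> a x y /=; rewrite (linearP k1) (linearP k2) scalerDr addrACA.
pose k12 : {linear (P * Q)%type -> A} := HB.pack
  (fun x : P * Q => k1 x.1 + k2 x.2)
  (GRing.isLinear.Build R (P * Q)%type A _ _ kL).
exists k12 => -[x y] /=.
rewrite (raddfD r). have := k1E x; rewrite /= => -> ; have := k2E y; rewrite /= => ->; rewrite -(raddfD h); congr (h _).
by congr (_, _); rewrite /= ?addr0 ?add0r.
Qed.
HB.instance Definition _ :=
  GRing.isZmodClosed.Build {linear M -> N} factors_proj factors_proj_zmod.

Definition stable_hom : zmodType := Quotient.quot factors_proj.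
Definition stable_class (f : {linear M -> N}) : stable_hom := \pi_stable_hom f.
End Stable.

Section Kernel.
Variables (M N : lmodType R) (f : {linear M -> N}).

Definition kermod_pred : {pred M} := fun x => f x == 0.
Lemma kermod_closed : submod_closed kermod_pred.
Proof.
split => [|a x y]; rewrite !unfold_in ?raddf0 // linearP => /eqP-> /eqP->.
by rewrite scaler0 addr0.
Qed.
HB.instance Definition _ := GRing.isSubmodClosed.Build R M kermod_pred kermod_closed.

Definition kermod : Type := {x | kermod_pred x}.
HB.instance Definition _ := [isSub of kermod for sval].
HB.instance Definition _ := [Choice of kermod by <:].
HB.instance Definition _ := [SubChoice_isSubLmodule of kermod by <:].
End Kernel.

(* ... -> P 1 -> P 0 -> M, with P 0 in degree 0 and M in degree -1. *)
Record aug_complex (M : lmodType R) := AugComplex {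
  cmod :> nat -> lmodType R;
  cdiff : forall k, {linear cmod k.+1 -> cmod k};
  caug : {linear cmod 0 -> M};
  caug_diff : forall x, caug (cdiff 0 x) = 0;
  cdiff_diff : forall k x, cdiff k (cdiff k.+1 x) = 0
}.

Definition proj_resolution (M : lmodType R) (P : aug_complex M) : Prop :=
  [/\ forall k, projective (P k),
      forall y, exists x, caug P x = y,
      forall x, caug P x = 0 -> exists y, cdiff P 0 y = x
    & forall k x, cdiff P k x = 0 -> exists y, cdiff P k.+1 y = x].

Section Syzygies.
Variables (M : lmodType R) (P : aug_complex M).

(* P_{k-1}, where P_{-1} = M. *)
Definition ctarget (k : nat) : lmodType R := if k is j.+1 then P j else M.
Definition cboundary (k : nat) : {linear P k -> ctarget k} :=
  match k with 0 => caug P | j.+1 => cdiff P j end.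
(* Omega^k M = ker (P_{k-1} -> P_{k-2}) for k >= 1, and Omega^0 M = M. *)
Definition syzygy (k : nat) : lmodType R :=
  if k is j.+1 then kermod (cboundary j) else M.
Definition syzygy_val (k : nat) : syzygy k.+1 -> P k :=
  fun x : kermod (cboundary k) => val x.

End Syzygies.

(* Chain maps lifting the identity of M. *)
Definition chain_map (M : lmodType R) (P Q : aug_complex M)
    (phi : forall k, {linear P k -> Q k}) : Prop :=
  (forall x, caug Q (phi 0 x) = caug P x) /\
  (forall k x, cdiff Q k (phi k.+1 x) = phi k (cdiff P k x)).

(* h represents Omega^{n+1} applied to g : M -> Omega^{m+1} M.  The resolution of
   Omega^{m+1} M used here is the truncation ... -> P_{m+2} -> P_{m+1} of P, with
   unchanged differentials, so that Omega^{n+1} (Omega^{m+1} M) is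
   Omega^{n+m+2} M; phi is a chain map lifting g, and h is what it induces on
   syzygies. *)
Definition syzygy_functor (M : lmodType R) (P : aug_complex M) (n m : nat)
    (g : {linear M -> syzygy P m.+1})
    (h : {linear syzygy P n.+1 -> syzygy P (n.+1 + m.+1)}) : Prop :=
  exists phi : forall i, {linear P i -> P (i + m.+1)},
    [/\ forall x, cdiff P m (phi 0 x) = syzygy_val (g (caug P x)),
        forall i x, cdiff P (i + m.+1) (phi i.+1 x) = phi i (cdiff P i x)
      & forall x, syzygy_val (h x) = phi n (syzygy_val x)].

End StableHom.

Section Tate.
Variable gT : finGroupType.
Local Notation ZG := (groupring gT).
Local Notation Z := (trivZ gT).
Implicit Types (F P : aug_complex Z).

(* The Tate group of degree -k, for k > 0. *)
Definition tate F k : zmodType := stable_hom Z (syzygy F k).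

(* The graph of the cup product. *)
Definition cup F n m (u : tate F n.+1) (v : tate F m.+1)
    (w : tate F (n.+1 + m.+1)) : Prop :=
  exists (f : {linear Z -> syzygy F n.+1}) (g : {linear Z -> syzygy F m.+1})
         (h : {linear syzygy F n.+1 -> syzygy F (n.+1 + m.+1)}),
    [/\ u = stable_class f, v = stable_class g, syzygy_functor g h
      & w = stable_class (h \o f)].

(* P (x)_{Z[G]} Z; the complex is not augmented here, so degree 0 has zero
   differential. *)
Definition cotensor F k : zmodType := tensor (F k) Z.
Definition cotensor_diff F k : {additive cotensor F k -> cotensor F k.-1} :=
  match k with 0 => \0 | j.+1 => tens_map Z (cdiff F j) end.

Definition group_homology F k : zmodType :=
  homology (cotensor_diff F k.+1) (cotensor_diff F k).

(* t is a cycle and a is its homology class. *)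
Definition has_class F k (t : cotensor F k) (a : group_homology F k) : Prop :=
  exists c : zker (cotensor_diff F k), val c = t /\ a = homology_class _ c.

(* The graph of the isomorphism from degree -k-1 Tate cohomology to H_k. *)
Definition tate_homology F k (u : tate F k.+1) (a : group_homology F k) : Prop :=
  exists (f : {linear Z -> syzygy F k.+1}) (y : F k),
    [/\ u = stable_class f, syzygy_val (f (one_trivZ gT)) = gr_norm gT *: y
      & has_class (tens y (one_trivZ gT)) a].

(* The graph of the product on homology obtained by transporting the cup product
   along these isomorphisms. *)
Definition tate_product F n m (a : group_homology F n) (b : group_homology F m)
    (c : group_homology F (n + m.+1)) : Prop :=
  exists u v w, [/\ tate_homology u a, tate_homology v b, cup u v w
                  & tate_homology (k := n + m.+1) w c].

(* a and a' are the same element of H_k(G, Z), computed with F and with P. *)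
Definition same_homology F P k (a : group_homology F k) (a' : group_homology P k)
    : Prop :=
  exists phi, chain_map phi /\
    exists t, has_class t a /\ has_class (tens_map Z (phi k) t) a'.

Definition inv_cycle P k (z : P k) : Prop :=
  (forall g : gT, gr_elt g *: z = z) /\ cboundary P k z = 0.

(* The class a of H_k(G, Z), computed with F, corresponds to the map
   Z -> Omega_P^{k+1} Z, 1 |-> z. *)
Definition represents F P k (z : P k) (a : group_homology F k) : Prop :=
  exists f : {linear Z -> syzygy P k.+1},
    syzygy_val (f (one_trivZ gT)) = z /\
    exists a', tate_homology (stable_class f) a' /\ same_homology a a'.

Definition biadditive (A B C : zmodType) (mu : A -> B -> C) : Prop :=
  (forall b, zmod_morphism (mu^~ b)) /\ (forall a, zmod_morphism (mu a)).
End Tate.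
Arguments inv_cycle {gT} P k z.
Arguments represents {gT F} P {k} z a.

Section TopologyFacts.

Lemma continuous_pair (T X Y : topologicalType) (f : T -> X) (g : T -> Y) :
  continuous f -> continuous g -> continuous (fun x => (f x, g x)).
Proof. by move=> fc gc x; apply: cvg_pair; [exact: fc | exact: gc]. Qed.

Lemma continuous_fst (X Y : topologicalType) : continuous (@fst X Y).
Proof. by move=> x; exact: cvg_fst. Qed.

Lemma continuous_snd (X Y : topologicalType) : continuous (@snd X Y).
Proof. by move=> x; exact: cvg_snd. Qed.

Lemma continuous_compo (X Y Z : topologicalType) (f : X -> Y) (g : Y -> Z) :
  continuous f -> continuous g -> continuous (fun x => g (f x)).
Proof. by move=> fc gc x; apply: continuous_comp; [exact: fc | exact: gc]. Qed.

Lemma continuous_row (R : realType) (T : topologicalType) n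
    (f : T -> 'rV[R]_n) :
  (forall j, continuous (fun x => f x ord0 j)) -> continuous f.
Proof.
move=> fc x U [P Pn PU]; rewrite nbhs_simpl /=.
have: \forall y \near x, forall j, P ord0 j (f y ord0 j).
  by apply: filter_forall => j; apply: fc; exact: Pn.
by apply: filterS => y Py; apply: PU => i j; rewrite (ord1 i).
Qed.

Lemma continuous_sumr (R : realType) (T : topologicalType) (I : Type)
    (r : seq I) (P : pred I) (f : I -> T -> R) :
  (forall i, P i -> continuous (f i)) ->
  continuous (fun x => \sum_(i <- r | P i) f i x).
Proof.
by move=> fc; apply: continuous_big => //; exact: add_continuous.
Qed.

Lemma continuous_set_type (T X : topologicalType) (A : set X) (f : T -> A) :
  continuous (fun x => val (f x)) -> continuous f.
Proof. exact: continuous_comp_initial. Qed.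

Lemma continuous_val (X : topologicalType) (A : set X) :
  continuous (val : A -> X).
Proof. exact: initial_continuous. Qed.

Lemma compact_set_type (X : topologicalType) (A : set X) (a : A) :
  compact A -> compact [set: A].
Proof.
move=> cA; have e : (insubd a) @` A = [set: A].
  apply/seteqP; split => // x _; exists (val x); last exact: valKd.
  exact/set_mem/valP.
rewrite -e; apply: continuous_compact => //.
apply/subspace_sigL_continuousP.
have -> : sigL A (insubd a) = id by apply/funext => y; rewrite /sigL /= set_valE valKd.
by move=> x; exact: cvg_id.
Qed.

Lemma hausdorff_set_type (X : topologicalType) (A : set X) :
  hausdorff_space X -> hausdorff_space A.
Proof.
move=> hX p q pq; apply: val_inj; apply: hX => U V pU qV.
have [z [Uz Vz]] := pq _ _ (@continuous_val _ A p _ pU) (@continuous_val _ A q _ qV).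
by exists (val z).
Qed.

End TopologyFacts.

Section GSpaces.
Variable gT : finGroupType.

Record gspace := GSpace {
  gsp :> topologicalType;
  gact : gT -> gsp -> gsp;
  gact1 : gact 1%g =1 id;
  gactM : forall g h x, gact (g * h)%g x = gact g (gact h x);
  gact_continuous : forall g, continuous (gact g)
}.

HB.instance Definition _ (X : gspace) (g : gT) :=
  isContinuous.Build X X (@gact X g) (@gact_continuous X g).

Definition free_action (X : gspace) : Prop :=
  forall (g : gT) (x : X), gact g x = x -> g = 1%g.

End GSpaces.

Section RealTopology.
Variable R : realType.

Definition unit_itv : topologicalType := [set t : R | 0 <= t <= 1].

Definition contractible (X : topologicalType) : Prop :=
  exists (x0 : X) (h : X * unit_itv -> X),
    [/\ continuous h,
        forall x t, val t = 0 -> h (x, t) = x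
      & forall x t, val t = 1 -> h (x, t) = x0].

Definition sqnorm n (x : 'rV[R]_n) : R := \sum_i x ord0 i ^+ 2.
Definition disc n : topologicalType := [set x : 'rV[R]_n | sqnorm x <= 1].

(* For A included in S: A is closed in the subspace S. *)
Definition rel_closed (X : topologicalType) (S A : set X) : Prop :=
  exists2 B, closed B & A = B `&` S.

(* G-CW structures: skel n is obtained from skel (n - 1), with skel (-1) empty, by
   attaching the G-cells G/stab j x D^n along the equivariant maps
   (g, y) |-> g (char_map j y); skel_topology says that skel n has the topology
   of the pushout, weak_topology that X is the colimit of its skeleta. *)
Record gcw_structure (gT : finGroupType) (X : gspace gT) := GCW {
  skel : nat -> set X;
  skel_pred := fun n => if n is k.+1 then skel k else set0;
  cell : nat -> Type;
  stab : forall n, cell n -> {group gT};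
  char_map : forall n, cell n -> disc n -> X;
  char_continuous : forall n (j : cell n), continuous (char_map j);
  char_stab : forall n (j : cell n) h y, h \in stab j ->
    gact h (char_map j y) = char_map j y;
  char_boundary : forall n (j : cell n) y, sqnorm (val y) = 1 ->
    skel_pred n (char_map j y);
  skelE : forall n x, skel n x <-> skel_pred n x \/
    exists (j : cell n) (g : gT) (y : disc n),
      sqnorm (val y) < 1 /\ x = gact g (char_map j y);
  cell_new : forall n (j : cell n) g y, sqnorm (val y) < 1 ->
    ~ skel_pred n (gact g (char_map j y));
  cell_inj : forall n (j j' : cell n) g g' y y',
    sqnorm (val y) < 1 -> sqnorm (val y') < 1 ->
    gact g (char_map j y) = gact g' (char_map j' y') ->
    [/\ j = j', y = y' & (g^-1 * g')%g \in stab j];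
  skel_topology : forall n (A : set X), A `<=` skel n ->
    (rel_closed (skel n) A <->
      rel_closed (skel_pred n) (A `&` skel_pred n) /\
      forall (j : cell n) g, closed [set y | A (gact g (char_map j y))]);
  skel_cover : forall x, exists n, skel n x;
  weak_topology : forall A : set X,
    closed A <-> forall n, rel_closed (skel n) (A `&` skel n)
}.

Definition std_simplex n : set 'rV[R]_n.+1 :=
  [set x | (forall i, 0 <= x ord0 i) /\ \sum_i x ord0 i = 1].
Definition simplex n : topologicalType := @std_simplex n.

Section SimplexMap.
Variables (n m : nat) (f : 'I_n.+1 -> 'I_m.+1).

(* The affine map that sends the vertex k to the vertex f k. *)
Definition simplex_map_row (x : 'rV[R]_n.+1) : 'rV[R]_m.+1 :=
  \row_l \sum_(k | f k == l) x ord0 k.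

Lemma simplex_map_subproof (x : simplex n) :
  simplex_map_row (val x) \in @std_simplex m.
Proof.
have [x0 x1] := set_mem (valP x).
apply/mem_set; split => [l|].
  by rewrite mxE; apply: sumr_ge0 => k _; exact: x0.
under eq_bigr do rewrite mxE.
rewrite -{}[RHS]x1 (partition_big f xpredT) //=.
Qed.

Definition simplex_map (x : simplex n) : simplex m :=
  exist _ (simplex_map_row (val x)) (simplex_map_subproof x).

Lemma simplex_map_continuous : continuous simplex_map.
Proof.
apply: continuous_set_type; apply: continuous_row => j.
rewrite [X in continuous X](_ : _ =
    (fun x : simplex n => \sum_(k | f k == j) val x ord0 k)); last first.
  by apply/funext => x; rewrite mxE.
apply: continuous_sumr => k _ x.
have := @coord_continuous R 1 n.+1 ord0 k (val x).
exact: (continuous_comp (@continuous_val _ (@std_simplex n) x)).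
Qed.
HB.instance Definition _ :=
  isContinuous.Build (simplex n) (simplex m) simplex_map simplex_map_continuous.

End SimplexMap.

Lemma simplex_map_comp n m p (f : 'I_n.+1 -> 'I_m.+1) (g : 'I_m.+1 -> 'I_p.+1) x :
  simplex_map g (simplex_map f x) = simplex_map (g \o f) x.
Proof.
apply: val_inj; apply/rowP => l; rewrite !mxE.
under eq_bigr do rewrite mxE.
rewrite [RHS](partition_big f (fun k => g k == l)) //=; apply: eq_bigr => k /eqP gk.
by apply: eq_bigl => i; case: (f i =P k) => [fi|]; rewrite ?andbF //= fi gk eqxx.
Qed.

Definition face n (i : 'I_n.+2) : continuousType (simplex n) (simplex n.+1) :=
  simplex_map (fintype.lift i).

Definition sing (X : topologicalType) n : choiceType :=
  continuousType (simplex n) X.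

Section Chains.
Variables (gT : finGroupType).
Local Notation ZG := (groupring gT).
Implicit Types X : gspace gT.

Definition chain X n : Type := {freeg (sing X n) / int}.
HB.instance Definition _ X n :=
  GRing.Zmodule.copy (chain X n) {freeg (sing X n) / int}.

Definition sing_act X n (g : gT) (s : sing X n) : sing X n := gact g \o s.
Definition chain_act X n (g : gT) : chain X n -> chain X n :=
  free_map (@sing_act X n g).

Fact chain_actB X n g : zmod_morphism (@chain_act X n g).
Proof. exact: free_map_is_zmod_morphism. Qed.
HB.instance Definition _ X n g :=
  GRing.isZmodMorphism.Build _ _ (@chain_act X n g) (@chain_actB X n g).

Fact chain_act1 X n : @chain_act X n 1%g =1 id.
Proof.
move=> x; rewrite -[RHS]free_map_id /chain_act; congr (free_map _ x).
by apply/funext => s; apply/continuousEP => y; exact: gact1.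
Qed.

Fact chain_actM X n g h x :
  @chain_act X n (g * h)%g x = chain_act g (chain_act h x).
Proof.
rewrite /chain_act -[RHS]/((free_map _ \o free_map _) x) -free_map_comp.
congr (free_map _ x).
by apply/funext => s; apply/continuousEP => y; exact: gactM.
Qed.

HB.instance Definition _ X n := GRing.Zmodule_isLmodule.Build ZG (chain X n)
  (gr_scaleA (@chain_actM X n) (@chain_actB X n))
  (gr_scale1 (@chain_act1 X n))
  (gr_scaleDr (@chain_actB X n))
  (@gr_scaleDl gT _ (@chain_act X n)).

Lemma chain_actE X n g (c : chain X n) : gr_elt g *: c = chain_act g c.
Proof. exact: gr_scaleE. Qed.

Lemma chain_actU X n g k (s : sing X n) :
  chain_act g << k *g s >> = << k *g sing_act g s >>.
Proof. exact: free_mapU. Qed.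

Lemma equivariant_linear X n (V : lmodType ZG) (f : chain X n -> V) :
  zmod_morphism f -> (forall g s, f << sing_act g s >> = gr_elt g *: f << s >>) ->
  linear f.
Proof.
move=> fB fg a x y.
pose F : {additive chain X n -> V} :=
  HB.pack f (GRing.isZmodMorphism.Build _ _ f fB).
rewrite -[f]/(F : _ -> _) raddfD; congr (_ + _).
rewrite -[a *: x]/(gr_scale (@chain_act X n) a x) /gr_scale raddf_sum.
rewrite {2}(groupringE a) scaler_suml; apply: eq_bigr => g _.
rewrite raddfMz -scalerMzl; congr (_ *~ _) => /=.
move: x; apply: (@freeg_ext (sing X n) V (f \o chain_act g) (fun x => gr_elt g *: f x)).
- by move=> x x'; rewrite /= raddfB fB.
- by move=> x x'; rewrite -scalerBr -fB.
- by move=> s; rewrite /= -fg chain_actU.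
Qed.

Definition sing_boundary X n (s : sing X n.+1) : {freeg (sing X n) / int} :=
  \sum_(i < n.+2) << (-1) ^+ i *g (s \o face i : sing X n) >>.

Definition chain_boundary X n : chain X n.+1 -> chain X n :=
  fglift (@sing_boundary X n).

Definition chain_augmentation X : chain X 0 -> trivZ gT :=
  fglift (fun=> 1 : int^o).

Lemma chain_boundaryU X n s : @chain_boundary X n << s >> = sing_boundary s.
Proof. by rewrite /chain_boundary liftU scale1r. Qed.

Fact chain_boundary_linear X n : linear (@chain_boundary X n).
Proof.
apply: equivariant_linear => [|g s]; first exact: lift_is_additive.
rewrite !chain_boundaryU chain_actE /sing_boundary.
rewrite [RHS](raddf_sum (@chain_act X n g)); apply: eq_bigr => i _.
rewrite [RHS]chain_actU; congr << _ *g _ >>.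
by apply/continuousEP.
Qed.
HB.instance Definition _ X n := GRing.isLinear.Build ZG (chain X n.+1)
  (chain X n) _ (@chain_boundary X n) (@chain_boundary_linear X n).

Lemma chain_augmentationU X k s :
  @chain_augmentation X << k *g s >> = k :> int.
Proof. by rewrite /chain_augmentation liftU; exact: mulr1. Qed.

Fact chain_augmentation_linear X : linear (@chain_augmentation X).
Proof.
apply: equivariant_linear => [|g s]; first exact: (@lift_is_additive _ _ int^o).
by rewrite trivZ_actE; apply: etrans (chain_augmentationU _ _) (esym (chain_augmentationU _ _)).
Qed.
HB.instance Definition _ X := GRing.isLinear.Build ZG (chain X 0)
  (trivZ gT) _ (@chain_augmentation X) (@chain_augmentation_linear X).

Fact chain_augmentation_boundary X x :
  @chain_augmentation X (chain_boundary x) = 0.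
Proof.
move: x; apply: (@freeg_ext (sing X 1) (trivZ gT)
  (@chain_augmentation X \o @chain_boundary X 0) (fun=> 0)).
- by move=> x y /=; rewrite !raddfB.
- by move=> x y; rewrite subrr.
move=> s; rewrite /= chain_boundaryU /sing_boundary raddf_sum.
by rewrite !big_ord_recl big_ord0 /= addr0 -[RHS](@subrr (trivZ gT) (one_trivZ gT));
  congr (_ + _); exact: chain_augmentationU.
Qed.

Lemma face_face n (i j : 'I_n.+2) x : (i <= j)%N ->
  face (fintype.lift ord0 j) (face i x) =
  face (widen_ord (leqnSn _) i) (face j x).
Proof.
move=> ij; apply: etrans (simplex_map_comp (fintype.lift i) _ x) _.
apply: etrans (esym (simplex_map_comp (fintype.lift j) _ x)); congr (simplex_map _ x).
apply/funext => k; apply: val_inj => /=.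
rewrite !/bump; move: ij; lia.
Qed.

Fact chain_boundary_boundary X n x :
  @chain_boundary X n (chain_boundary x) = 0.
Proof.
move: x; apply: (@freeg_ext (sing X n.+2) (chain X n)
  (@chain_boundary X n \o @chain_boundary X n.+1) (fun=> 0)).
- by move=> x y /=; rewrite !raddfB.
- by move=> x y; rewrite subrr.
move=> s; rewrite /= chain_boundaryU /sing_boundary raddf_sum /=.
pose F (j : 'I_n.+3) (i : 'I_n.+2) : {freeg (sing X n) / int} :=
  << (-1) ^+ (j + i) *g (s \o face j \o face i : sing X n) >>.
transitivity (\sum_j \sum_i F j i).
  apply: eq_bigr => j _; rewrite /chain_boundary liftU scaler_sumr.
  apply: eq_bigr => i _; apply/eqP/freeg_eqP => z.
  by rewrite coeffZ !coeffU exprD mulrA.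
under eq_bigr => j _ do rewrite (bigID (fun i : 'I_n.+2 => i < j)%N) /=.
rewrite big_split /= big_ord_recl big_pred0 // add0r.
have -> : \sum_(j < n.+3) \sum_(i < n.+2 | ~~ (i < j)%N) F j i =
          \sum_(i < n.+2) \sum_(j < n.+2 | (j <= i)%N) F (widen_ord (leqnSn _) j) i.
  rewrite (exchange_big_dep xpredT) //=; apply: eq_bigr => i _.
  rewrite big_mkcond big_ord_recr /= ltn_ord addr0 [RHS]big_mkcond /=.
  by apply: eq_bigr => j _; rewrite -leqNgt.
rewrite -big_split big1 // => j _ /=; rewrite -big_split big1 // => i.
rewrite /bump leq0n add1n ltnS => ij.
rewrite /F /= /bump leq0n add1n addSn exprS mulN1r addnC -freegUN.
have e : (s \o face (fintype.lift ord0 j) \o face i : sing X n) =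
         (s \o face (widen_ord (leqnSn _) i) \o face j : sing X n).
  by apply/continuousEP => x /=; congr (s _); exact: face_face.
by rewrite e addNr.
Qed.


Definition singular_complex X : aug_complex (trivZ gT) :=
  @AugComplex ZG (trivZ gT) (fun n => chain X n) (@chain_boundary X)
    (@chain_augmentation X) (@chain_augmentation_boundary X)
    (@chain_boundary_boundary X).

End Chains.
Section Join.
Variables X Y : topologicalType.

(* The join is the quotient of X * Y * [0, 1] that forgets y at t = 0 and x at
   t = 1. *)
Definition join_eq (p q : X * Y * unit_itv) : bool :=
  `[< [/\ p.2 = q.2, val p.2 <> 1 -> p.1.1 = q.1.1
        & val p.2 <> 0 -> p.1.2 = q.1.2] >].

Fact join_eq_equiv : equiv_class_of join_eq.
Proof.
split=> [p|p q|q p r].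
- exact/asboolP.
- by apply/asboolP/asboolP => -[e e1 e2]; split; rewrite ?e // -e => h;
    rewrite ?e1 ?e2.
move=> /asboolP[e e1 e2] /asboolP[f f1 f2]; apply/asboolP; split.
- by rewrite e.
- by move=> h; rewrite e1 // f1 // -e.
- by move=> h; rewrite e2 // f2 // -e.
Qed.
Canonical join_equiv := EquivRelPack join_eq_equiv.
Canonical join_encModRel := defaultEncModRel join_eq.

Definition join : topologicalType := quotient_topology {eq_quot join_eq}.

Definition join_pt (x : X) (y : Y) (t : unit_itv) : join :=
  \pi_{eq_quot join_eq} (x, y, t).

Lemma join_pt_eq x y t x' y' t' : t = t' -> (val t <> 1 -> x = x') ->
  (val t <> 0 -> y = y') -> join_pt x y t = join_pt x' y' t'.
Proof. by move=> e e1 e2; apply/eqmodP/asboolP. Qed.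

Lemma join_ptP (q : join) : exists x y t, q = join_pt x y t.
Proof.
exists (repr q).1.1, (repr q).1.2, (repr q).2.
by rewrite /join_pt -!surjective_pairing reprK.
Qed.
End Join.

Section JoinGSpace.
Variables (gT : finGroupType) (X Y : gspace gT).

Definition join_act (g : gT) (q : join X Y) : join X Y :=
  let p := repr (q : {eq_quot @join_eq X Y}) in
  join_pt (gact g p.1.1) (gact g p.1.2) p.2.

Lemma join_actE g x y t :
  join_act g (join_pt x y t) = join_pt (gact g x) (gact g y) t.
Proof.
rewrite /join_act /join_pt; case: piP => -[[x' y'] t'] /eqmodP/asboolP[/= e e1 e2].
by apply: join_pt_eq; rewrite -?e // => h; rewrite ?e1 ?e2.
Qed.

Fact join_act1 : join_act 1%g =1 id.
Proof.
by move=> q; have [x [y [t ->]]] := join_ptP q; rewrite join_actE !gact1.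
Qed.

Fact join_actM g h q : join_act (g * h)%g q = join_act g (join_act h q).
Proof.
by have [x [y [t ->]]] := join_ptP q; rewrite !join_actE !gactM.
Qed.

Fact join_act_continuous g : continuous (join_act g).
Proof.
apply/quotient_continuous.
rewrite (_ : _ \o _ = \pi_(quotient_topology {eq_quot @join_eq X Y}) \o
   (fun p : X * Y * unit_itv => (gact g p.1.1, gact g p.1.2, p.2))).
  apply: continuous_compo; last exact: pi_continuous.
  apply: continuous_pair; last exact: continuous_snd.
  apply: continuous_pair; (apply: continuous_compo; last exact: gact_continuous).
    by apply: continuous_compo; [exact: continuous_fst | exact: continuous_fst].
  by apply: continuous_compo; [exact: continuous_fst | exact: continuous_snd].
by apply/funext => -[[x y] t]; exact: join_actE.
Qed.

Definition join_gspace : gspace gT :=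
  GSpace join_act1 join_actM join_act_continuous.
End JoinGSpace.

Lemma vertex_subproof n (i : 'I_n.+1) : delta_mx ord0 i \in @std_simplex n.
Proof.
apply/mem_set; split => [k|]; first by rewrite mxE ler0n.
rewrite (bigD1 i) //= big1 => [|k ki]; first by rewrite mxE !eqxx addr0.
by rewrite mxE (negPf ki) andbF.
Qed.
Definition vertex n (i : 'I_n.+1) : simplex n := exist _ (delta_mx ord0 i) (vertex_subproof i).

Lemma itv0_subproof : (0 : R) \in [set t : R | 0 <= t <= 1].
Proof. by apply/mem_set; rewrite /= lexx ler01. Qed.
Definition itv0 : unit_itv := exist _ 0 itv0_subproof.

(* Since n.+1 + m.+1 is convertible to (n + m.+1).+1, the first n + 1 and the last
   m + 1 coordinates of a point p of the (n + m + 1)-simplex are its components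
   along Delta^n * Delta^m: p = (1 - t) x + t y with x = simplex_fst p,
   y = simplex_snd p and t = simplex_wt p (simplex_joinK).  The join of s and t
   maps (1 - w) x + w y to join_pt (s x) (t y) w (join_simplex_funE). *)
Section JoinSimplex.
Variables (X Y : topologicalType) (n m : nat).

(* When u = 0, this is an arbitrary point, namely a vertex. *)
Definition to_simplex k (u : 'rV[R]_k.+1) : simplex k :=
  insubd (vertex ord0) ((\sum_i u ord0 i)^-1 *: u).

Definition simplex_fst (p : simplex (n + m.+1)) : simplex n :=
  to_simplex (lsubmx (val p : 'rV[R]_(n.+1 + m.+1))).
Definition simplex_snd (p : simplex (n + m.+1)) : simplex m :=
  to_simplex (rsubmx (val p : 'rV[R]_(n.+1 + m.+1))).
Definition simplex_wt (p : simplex (n + m.+1)) : unit_itv :=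
  insubd itv0 (\sum_i rsubmx (val p : 'rV[R]_(n.+1 + m.+1)) ord0 i).

Definition join_simplex_fun (s : sing X n) (t : sing Y m) (p : simplex (n + m.+1))
    : join X Y :=
  join_pt (s (simplex_fst p)) (t (simplex_snd p)) (simplex_wt p).

Definition simplex_join_row (x : 'rV[R]_n.+1) (y : 'rV[R]_m.+1) (t : R)
    : 'rV[R]_(n + m.+1).+1 :=
  row_mx ((1 - t) *: x) (t *: y) : 'rV[R]_(n.+1 + m.+1).

Lemma simplex_join_rowl x y t k :
  simplex_join_row x y t ord0 (@lshift n.+1 m.+1 k) = (1 - t) * x ord0 k.
Proof. exact: etrans (row_mxEl _ _ _ _) (mxE _ _ _ _). Qed.

Lemma simplex_join_rowr x y t k :
  simplex_join_row x y t ord0 (@rshift n.+1 m.+1 k) = t * y ord0 k.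
Proof. exact: etrans (row_mxEr _ _ _ _) (mxE _ _ _ _). Qed.

Lemma simplex_join_rowKl x y t :
  lsubmx (simplex_join_row x y t : 'rV[R]_(n.+1 + m.+1)) = (1 - t) *: x.
Proof. exact: row_mxKl. Qed.

Lemma simplex_join_rowKr x y t :
  rsubmx (simplex_join_row x y t : 'rV[R]_(n.+1 + m.+1)) = t *: y.
Proof. exact: row_mxKr. Qed.

Lemma simplex_join_subproof (x : simplex n) (y : simplex m) (t : unit_itv) :
  simplex_join_row (val x) (val y) (val t) \in @std_simplex (n + m.+1).
Proof.
have [x0 x1] := set_mem (valP x); have [y0 y1] := set_mem (valP y).
have /andP[t0 t1] := set_mem (valP t).
apply/mem_set; split => [i|].
  case: (@split_ordP n.+1 m.+1 i) => k ->.
  - by rewrite simplex_join_rowl mulr_ge0 ?subr_ge0.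
  - by rewrite simplex_join_rowr mulr_ge0.
rewrite (@big_split_ord _ _ _ n.+1 m.+1) /=.
under eq_bigr do rewrite simplex_join_rowl.
under [X in _ + X]eq_bigr do rewrite simplex_join_rowr.
by rewrite -!mulr_sumr x1 y1 !mulr1 subrK.
Qed.
Definition simplex_join x y t : simplex (n + m.+1) :=
  exist _ (simplex_join_row (val x) (val y) (val t)) (simplex_join_subproof x y t).

Lemma to_simplexZ k (x : simplex k) (c : R) : c != 0 ->
  to_simplex (c *: val x) = x.
Proof.
move=> c0; have [x0 x1] := set_mem (valP x).
rewrite /to_simplex; under eq_bigr do rewrite mxE.
by rewrite -mulr_sumr x1 mulr1 scalerA mulVf // scale1r valKd.
Qed.

Lemma simplex_wt_join x y t : simplex_wt (simplex_join x y t) = t.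
Proof.
have [y0 y1] := set_mem (valP y).
rewrite /simplex_wt /= simplex_join_rowKr.
under eq_bigr do rewrite mxE.
by rewrite -mulr_sumr y1 mulr1 valKd.
Qed.

Lemma join_simplex_funE s t x y w :
  join_simplex_fun s t (simplex_join x y w) = join_pt (s x) (t y) w.
Proof.
rewrite /join_simplex_fun simplex_wt_join; apply: join_pt_eq => // /eqP h.
  rewrite /simplex_fst /= simplex_join_rowKl to_simplexZ //.
  by rewrite subr_eq0 eq_sym.
by rewrite /simplex_snd /= simplex_join_rowKr to_simplexZ.
Qed.

Lemma to_simplexK k (u : 'rV[R]_k.+1) : (forall i, 0 <= u ord0 i) ->
  (\sum_i u ord0 i) *: val (to_simplex u) = u.
Proof.
move=> u0; have [/eqP s0|s0] := eqVneq (\sum_i u ord0 i) 0.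
  rewrite (eqP s0) scale0r; apply/esym/rowP => i; rewrite mxE.
  move: s0; rewrite psumr_eq0 => [/allP/(_ i)|? _]; last exact: u0.
  by rewrite mem_index_enum => /(_ isT)/eqP.
rewrite /to_simplex insubdK ?scalerA ?divff ?scale1r //.
apply/mem_set; split => [i|].
  by rewrite mxE mulr_ge0 // invr_ge0 sumr_ge0.
by under eq_bigr do rewrite mxE; rewrite -mulr_sumr mulVf.
Qed.

Lemma simplex_joinK p :
  simplex_join (simplex_fst p) (simplex_snd p) (simplex_wt p) = p.
Proof.
have [p0 p1] := set_mem (valP p).
set u := lsubmx (val p : 'rV[R]_(n.+1 + m.+1)).
set v := rsubmx (val p : 'rV[R]_(n.+1 + m.+1)).
have u0 i : 0 <= u ord0 i by rewrite mxE; exact: p0.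
have v0 i : 0 <= v ord0 i by rewrite mxE; exact: p0.
have uv : \sum_i u ord0 i + \sum_i v ord0 i = 1.
  rewrite -p1 (@big_split_ord _ _ _ n.+1 m.+1) /=.
  by congr (_ + _); apply: eq_bigr => i _; rewrite mxE.
have e : val (simplex_wt p) = \sum_i v ord0 i.
  rewrite /simplex_wt insubdK //; apply/mem_set => /=.
  by rewrite sumr_ge0 //= -uv lerDr sumr_ge0.
apply: val_inj; rewrite /= /simplex_join_row e.
rewrite -{1}uv addrK !to_simplexK //.
exact: (@hsubmxK _ 1 n.+1 m.+1 (val p)).
Qed.

Lemma simplex_coord_continuous k (i : 'I_k.+1) :
  continuous (fun x : simplex k => val x ord0 i).
Proof.
move=> x; have := @coord_continuous R 1 k.+1 ord0 i (val x).
exact: (continuous_comp (@continuous_val _ (@std_simplex k) x)).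
Qed.

Lemma simplex_join_continuous :
  continuous (fun q : simplex n * simplex m * unit_itv =>
    simplex_join q.1.1 q.1.2 q.2).
Proof.
apply: continuous_set_type; apply: continuous_row => j.
have c2 : continuous (fun q : simplex n * simplex m * unit_itv => val q.2).
  by apply: continuous_compo; [exact: continuous_snd | exact: continuous_val].
case: (@split_ordP n.+1 m.+1 j) => k ->.
- rewrite [X in continuous X](_ : _ = fun q : simplex n * simplex m * unit_itv =>
      (1 - val q.2) * val q.1.1 ord0 k); last first.
    by apply/funext => q; rewrite /= simplex_join_rowl.
  move=> q; apply: (@cvgM R).
    by apply: (@cvgB _ R^o); [exact: cvg_cst | exact: c2].
  apply: (@continuous_compo _ _ _
    (fun q : simplex n * simplex m * unit_itv => q.1.1) (fun x => val x ord0 k)).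
    by apply: continuous_compo; [exact: continuous_fst | exact: continuous_fst].
  exact: simplex_coord_continuous.
- rewrite [X in continuous X](_ : _ = fun q : simplex n * simplex m * unit_itv =>
      val q.2 * val q.1.2 ord0 k); last first.
    by apply/funext => q; rewrite /= simplex_join_rowr.
  move=> q; apply: (@cvgM R); first exact: c2.
  apply: (@continuous_compo _ _ _
    (fun q : simplex n * simplex m * unit_itv => q.1.2) (fun x => val x ord0 k)).
    by apply: continuous_compo; [exact: continuous_fst | exact: continuous_snd].
  exact: simplex_coord_continuous.
Qed.

Lemma simplex_compact k : compact [set: simplex k].
Proof.
apply: (compact_set_type (vertex ord0)).
apply: (@subclosed_compact _ _
  [set v : 'rV[R]_k.+1 | forall i, `[0, 1]%classic (v ord0 i)]).
- apply: closedI.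
    rewrite [X in closed X](_ : _ = \bigcap_i [set x : 'rV[R]_k.+1 | 0 <= x ord0 i]).
      apply: closed_bigI => i _; exact: ((continuous_closedP (fun x : 'rV[R]_k.+1 => x ord0 i)).1
        (@coord_continuous R 1 k.+1 ord0 i) _ (@closed_ge R 0)).
    by apply/seteqP; split => x /= h i; [move=> _ |]; apply: h.
  have c : continuous (fun x : 'rV[R]_k.+1 => \sum_i x ord0 i).
    by apply: continuous_sumr => i _; exact: coord_continuous.
  exact: ((continuous_closedP _).1 c _ (@closed_eq R 1)).
- apply: (@rV_compact R k.+1 (fun=> `[0, 1]%classic)) => i.
  exact: segment_compact.
move=> x [x0 x1] i /=; rewrite in_itv /= x0 /= -x1 (bigD1 i) //= lerDl.
exact: sumr_ge0.
Qed.

Lemma unit_itv_compact : compact [set: unit_itv].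
Proof.
apply: (compact_set_type itv0).
rewrite (_ : [set t : R | _] = `[0, 1]%classic); first exact: segment_compact.
by apply/seteqP; split => x /=; rewrite in_itv.
Qed.

Lemma simplex_hausdorff k : hausdorff_space (simplex k).
Proof. by apply: hausdorff_set_type; exact: norm_hausdorff. Qed.

Lemma join_simplex_continuous (s : sing X n) (t : sing Y m) :
  continuous (join_simplex_fun s t).
Proof.
apply/continuous_closedP => C Ccl.
pose Phi := fun q : simplex n * simplex m * unit_itv =>
    simplex_join q.1.1 q.1.2 q.2.
have -> : join_simplex_fun s t @^-1` C =
          Phi @` (Phi @^-1` (join_simplex_fun s t @^-1` C)).
  apply/seteqP; split => [p Cp|p [q Cq <-]] //.
  exists (simplex_fst p, simplex_snd p, simplex_wt p) => /=.
    by rewrite /Phi /= simplex_joinK.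
  exact: simplex_joinK.
apply: compact_closed; first exact: simplex_hausdorff.
apply: continuous_compact.
  by apply: continuous_subspaceT; exact: simplex_join_continuous.
apply: (@subclosed_compact _ _ setT) => //; last first.
  rewrite -!setXTT; apply: compact_setX; last exact: unit_itv_compact.
  by apply: compact_setX; exact: simplex_compact.
rewrite [X in closed X](_ : _ =
   (fun q : simplex n * simplex m * unit_itv =>
      join_pt (s q.1.1) (t q.1.2) q.2) @^-1` C); last first.
  by apply/seteqP; split => q; rewrite /= /Phi join_simplex_funE.
apply: (continuous_closedP _).1 => //.
apply: (@continuous_compo _ _ _
  (fun q : simplex n * simplex m * unit_itv => (s q.1.1, t q.1.2, q.2))
  (\pi_(quotient_topology {eq_quot @join_eq X Y}))); last exact: pi_continuous.
apply: continuous_pair; last exact: continuous_snd.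
apply: continuous_pair; (apply: continuous_compo; last exact: cts_fun).
  by apply: continuous_compo; [exact: continuous_fst | exact: continuous_fst].
by apply: continuous_compo; [exact: continuous_fst | exact: continuous_snd].
Qed.

Definition join_simplex (s : sing X n) (t : sing Y m)
    : sing (join X Y) (n + m.+1) :=
  mkcts (@join_simplex_continuous s t).

End JoinSimplex.

Section JoinChain.
Variables (gT : finGroupType) (X Y : gspace gT) (n m : nat).

Definition join_chain (z : chain X n) (w : chain Y m)
    : chain (join_gspace X Y) (n + m.+1) :=
  fglift (fun s => fglift (fun t =>
    << join_simplex s t >> : {freeg (sing (join X Y) (n + m.+1)) / int}) w) z.
End JoinChain.

End RealTopology.

(* Main.v *)
Require Import Defs.
From HB Require Import structures.
From mathcomp Require Import all_boot all_order all_algebra all_fingroup.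
From mathcomp Require Import ring_quotient generic_quotient.
From mathcomp Require Import all_classical all_reals all_analysis.
From mathcomp Require Import zify.
From mathcomp.multinomials Require Import freeg.

(** Write Z for the trivial module, N for the norm element, d for all the
    differentials and x (x) 1 for the image of x in the coinvariants of a
    module.

    On a projective resolution F, the Tate class that corresponds to the
    homology class of x (x) 1 is the class of the map 1 |-> N x.  Behind this is
    the fact that N x = 0 if and only if x (x) 1 = 0: the map x (x) 1 |-> N x is
    well defined on every module ([tens1_norm]), and on a projective module it
    is injective ([norm_tens1]), since such a module is a direct summand of one
    induced from the trivial group ([projective_transfer]).  Applying Omega^n to
    1 |-> N y, with y in F_m, amounts to choosing maps phi_i : F_i -> F_{i+m+1}
    that commute with d and lift 1 |-> N y; the composite with 1 |-> N x is then
    1 |-> phi_n (N x) = N phi_n(x).  So the product of the classes of x (x) 1 and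
    y (x) 1 is the class of phi_n(x) (x) 1 ([tate_productP]).  Two such families
    are homotopic, and in degrees n > 0 only the class of y (x) 1 matters, not y
    itself.  The general form of this remark is [lifts_natural], which also
    allows the resolution to change; it shows that the product is well defined
    and biadditive, and it is the tool for computing the product with other
    complexes ([represents_product]).

    On the topological side, the augmented singular complex of a contractible
    space is exact, by coning off simplices along the contraction
    ([singular_exact]), and the join of a contractible space with a nonempty
    space is contractible ([join_contractible]).  Let w be an invariant singular
    m-cycle of EG, with m > 0.  As d w = 0, the boundary formula for joins gives
    d (s * w) = d s * w for simplices s of positive degree, and d (s * w) = w
    (seen in the second factor of the join) for s of degree 0; as w is invariant,
    s |-> s * w is equivariant.  Hence s |-> s * w is one of the families above,
    from C(EG) to C(EG * EG), and it lifts 1 |-> w ([join_lift_lifts]).  If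
    z = N y in C_n(EG) then z * w = N (y * w), so z * w represents the product. *)

Set Implicit Arguments.
Unset Strict Implicit.
Unset Printing Implicit Defensive.
Import Order.TTheory GRing.Theory Num.Theory numFieldNormedType.Exports.

Local Open Scope ring_scope.

(** * Lifting maps of complexes *)

(** Dependent choice along a family of types indexed by nat. *)
Lemma dep_choice (S : nat -> Type) (R : forall i, S i -> S i.+1 -> Prop) (s0 : S 0) :
  (forall i s, exists s', @R i s s') ->
  exists f : forall i, S i, f 0 = s0 /\ forall i, R i (f i) (f i.+1).
Proof.
move=> H.
pose next i s := sval (cid (H i s)).
pose f := nat_rect S s0 next.
by exists f; split => // i; exact: svalP (cid (H i (f i))).
Qed.

Section Resolutions.
Variable R : nzRingType.

(** Exactness in all degrees k >= 0; nothing is asked in degree -1, so the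
    augmentation need not be surjective. *)
Definition exact_complex (M : lmodType R) (P : aug_complex M) : Prop :=
  (forall x, caug P x = 0 -> exists y, cdiff P 0 y = x) /\
  (forall k x, cdiff P k x = 0 -> exists y, cdiff P k.+1 y = x).

(** phi commutes with the differentials and lies over g in degree -1.  For g the
    identity this is [chain_map]. *)
Definition lifts (M N : lmodType R) (g : M -> N) (P : aug_complex M)
    (Q : aug_complex N) (phi : forall k, {linear P k -> Q k}) : Prop :=
  (forall x, caug Q (phi 0 x) = g (caug P x)) /\
  (forall k x, cdiff Q k (phi k.+1 x) = phi k (cdiff P k x)).

(** ... -> P_{m+2} -> P_{m+1}, augmented to P_m by the differential.  Maps into
    it are maps of degree m + 1 into P. *)
Definition shift_complex (M : lmodType R) (P : aug_complex M) (m : nat) :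
    aug_complex (P m) :=
  @AugComplex R (P m) (fun i => P (i + m.+1)%N) (fun i => cdiff P (i + m.+1))
    (cdiff P m) (cdiff_diff (a := P) (k := m)) (fun i => cdiff_diff (a := P) (k := (i + m.+1))).

Lemma shift_exact M (P : aug_complex M) m :
  exact_complex P -> exact_complex (shift_complex P m).
Proof. by case=> _ eP; split => [|k]; exact: eP. Qed.

(** Only the values of f have to be in the image of d: d need not be onto. *)
Lemma projective_lift (P A B : lmodType R) (d : {linear A -> B})
    (f : {linear P -> B}) :
  projective P -> (forall x, exists a, d a = f x) ->
  exists f' : {linear P -> A}, forall x, d (f' x) = f x.
Proof.
move=> pP im.
(* The pullback of f and d maps onto P; a section of it gives the lift. *)
have kL : linear (fun x : P * A => f x.1 - d x.2).
  by move=> a x y /=; rewrite (linearP f) (linearP d) opprD scalerBr addrACA.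
pose k : {linear (P * A)%type -> B} := HB.pack (fun x : P * A => f x.1 - d x.2)
  (GRing.isLinear.Build R _ _ _ _ kL).
have p1L : linear (fun x : kermod k => (val x).1) by [].
have p2L : linear (fun x : kermod k => (val x).2) by [].
pose p1 : {linear kermod k -> P} := HB.pack (fun x : kermod k => (val x).1)
  (GRing.isLinear.Build R _ _ _ _ p1L).
pose p2 : {linear kermod k -> A} := HB.pack (fun x : kermod k => (val x).2)
  (GRing.isLinear.Build R _ _ _ _ p2L).
have [|s sE] := pP _ _ p1 (idfun : {linear P -> P}).
  move=> x; have [a ax] := im x.
  have kx : kermod_pred k (x, a) by apply/eqP; rewrite /= ax subrr.
  by exists (exist _ (x, a) kx).
exists (p2 \o s : {linear P -> A}) => x /=.
have /eqP := valP (s x); rewrite /= => /eqP; rewrite subr_eq0 => /eqP <-.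
by rewrite -[(\val (s x)).1]/(p1 (s x)) sE.
Qed.

Section Lifting.
Variables (M N : lmodType R) (P : aug_complex M) (Q : aug_complex N).
Hypothesis projP : forall k, projective (P k).
Hypothesis exQ : exact_complex Q.

Let exQb k x : cboundary Q k x = 0 -> exists y, cdiff Q k y = x.
Proof. by case: exQ k x => e0 eS [|k]; [exact: e0 | exact: eS]. Qed.

Theorem lifts_ex (g : {linear M -> N}) :
  (forall x, exists y, caug Q y = g (caug P x)) ->
  exists phi, lifts g (P := P) (Q := Q) phi.
Proof.
move=> gQ.
have [phi0 phi0E] := projective_lift (d := caug Q) (f := g \o caug P) (@projP 0) gQ.
(* Step i of the construction remembers that phi_i sends boundaries to cycles,
   which is what the next step needs. *)
pose S i := {phi : {linear P i -> Q i} |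
  forall x, cboundary Q i (phi (cdiff P i x)) = 0}.
have S0 x : cboundary Q 0 (phi0 (cdiff P 0 x)) = 0.
  by rewrite /= phi0E /= caug_diff linear0.
have [|f [f0 fS]] := @dep_choice S
  (fun i u v => forall x, cdiff Q i (sval v x) = sval u (cdiff P i x)) (exist _ phi0 S0).
  move=> i [phi phiE].
  have [psi psiE] := projective_lift (d := cdiff Q i) (f := phi \o cdiff P i) (@projP i.+1)
    (fun x => exQb (phiE x)).
  have psiS x : cboundary Q i.+1 (psi (cdiff P i.+1 x)) = 0.
    by rewrite /= psiE /= cdiff_diff linear0.
  by exists (exist _ psi psiS).
by exists (fun i => sval (f i)); split => [x|i x]; [rewrite f0 /= phi0E | rewrite fS].
Qed.

(** Maps that lift 0 are null-homotopic; the equation in degree 0 is left out, as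
    only positive degrees will matter. *)
Theorem lifts_null_homotopy (chi : forall k, {linear P k -> Q k}) :
  lifts (fun=> 0) chi ->
  exists h : forall k, {linear P k -> Q k.+1},
    forall k x, chi k.+1 x = cdiff Q k.+1 (h k.+1 x) + h k (cdiff P k x).
Proof.
move=> [chi0 chiS].
have [h0 h0E] := projective_lift (d := cdiff Q 0) (f := chi 0) (@projP 0)
  (fun x => exQb (k := 0) (chi0 x)).
pose S i := {h : {linear P i -> Q i.+1} |
  forall x, cdiff Q i (h (cdiff P i x)) = chi i (cdiff P i x)}.
have S0 x : cdiff Q 0 (h0 (cdiff P 0 x)) = chi 0 (cdiff P 0 x) by rewrite h0E.
have [|f [f0 fS]] := @dep_choice S
  (fun i u v => forall x, chi i.+1 x = cdiff Q i.+1 (sval v x) + sval u (cdiff P i x))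
  (exist _ h0 S0).
  move=> i [h hE].
  have c x : cdiff Q i (chi i.+1 x - h (cdiff P i x)) = 0.
    by rewrite linearB /= hE chiS subrr.
  have [k kE] := projective_lift (d := cdiff Q i.+1) (f := chi i.+1 \- (h \o cdiff P i))
     (@projP i.+1) (fun x => exQb (k := i.+1) (c x)).
  have kS x : cdiff Q i.+1 (k (cdiff P i.+1 x)) = chi i.+1 (cdiff P i.+1 x).
    by rewrite kE /= cdiff_diff linear0 subr0.
  by exists (exist _ k kS) => x; rewrite /= kE /= subrK.
by exists (fun i => sval (f i)).
Qed.
End Lifting.
End Resolutions.

(** * Modules over the integral group ring *)

Section GroupRingModules.
Variable gT : finGroupType.
Local Notation ZG := (groupring gT).
Local Notation Z := (trivZ gT).
Local Notation one := (one_trivZ gT).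

Lemma gr_eltM (g h : gT) : gr_elt (g * h)%g = gr_elt g * gr_elt h.
Proof.
apply/ffunP => x; rewrite [RHS]ffunE (bigD1 g) //= big1 => [|k kg].
  rewrite !ffunE eqxx mul1r addr0 -(inj_eq (mulgI g) (g^-1 * x)%g).
  by rewrite mulKVg.
by rewrite ffunE (negPf kg) mul0r.
Qed.

Lemma gr_elt1 : gr_elt 1%g = 1 :> ZG. Proof. by []. Qed.

Lemma gr_scaleME (V : lmodType ZG) g h (x : V) :
  gr_elt g *: (gr_elt h *: x) = gr_elt (g * h)%g *: x.
Proof. by rewrite scalerA gr_eltM. Qed.

(** A group homomorphism that commutes with the action of the group is linear. *)
Lemma gr_linear (V W : lmodType ZG) (f : V -> W) : zmod_morphism f ->
  (forall g x, f (gr_elt g *: x) = gr_elt g *: f x) -> linear f.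
Proof.
move=> fB fg a x y.
pose F : {additive V -> W} := HB.pack f (GRing.isZmodMorphism.Build _ _ f fB).
rewrite -[f]/(F : _ -> _) raddfD; congr (_ + _).
rewrite {1 2}(groupringE a) !scaler_suml raddf_sum; apply: eq_bigr => g _.
by rewrite -!scalerMzl raddfMz /= fg.
Qed.

Lemma gr_normE (V : lmodType ZG) (x : V) : gr_norm gT *: x = \sum_g gr_elt g *: x.
Proof. by rewrite scaler_suml. Qed.

Lemma gr_norm_inv (V : lmodType ZG) g (x : V) :
  gr_elt g *: (gr_norm gT *: x) = gr_norm gT *: x.
Proof.
rewrite !gr_normE scaler_sumr [RHS](reindex_inj (mulgI g)).
by apply: eq_bigr => h _; rewrite gr_scaleME.
Qed.

(** The module induced from the trivial group, as functions on the group; the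
    function supported at 1 with value v stands for 1 (x) v.  An alias is needed
    because {ffun gT -> V} has a pointwise module structure when V has one. *)
Definition induced (V : zmodType) : Type := {ffun gT -> V}.
HB.instance Definition _ (V : zmodType) := GRing.Zmodule.copy (induced V) {ffun gT -> V}.

Section Induced.
Variable V : zmodType.
Definition induced_act (g : gT) (u : induced V) : induced V :=
  [ffun h => u (g^-1 * h)%g].
Fact induced_act1 : induced_act 1%g =1 id.
Proof. by move=> u; apply/ffunP => h; rewrite ffunE invg1 mul1g. Qed.
Fact induced_actM g h u : induced_act (g * h)%g u = induced_act g (induced_act h u).
Proof. by apply/ffunP => k; rewrite !ffunE invMg mulgA. Qed.
Fact induced_actB g : zmod_morphism (induced_act g).
Proof. by move=> u v; apply/ffunP => k; rewrite !ffunE. Qed.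
HB.instance Definition _ := GRing.Zmodule_isLmodule.Build ZG (induced V)
  (gr_scaleA induced_actM induced_actB) (gr_scale1 induced_act1)
  (gr_scaleDr induced_actB) (@gr_scaleDl gT _ induced_act).
Lemma induced_actE g (u : induced V) : gr_elt g *: u = induced_act g u.
Proof. exact: gr_scaleE. Qed.
End Induced.

(** A projective module has an additive endomorphism theta whose transfer is the
    identity. *)
Lemma projective_transfer (P : lmodType ZG) : projective P ->
  exists theta : {additive P -> P},
    forall x, \sum_g gr_elt g *: theta (gr_elt g^-1%g *: x) = x.
Proof.
move=> projP.
(* s is a section of the surjection g (x) x |-> g x from the induced module, and
   theta is the component of s at 1. *)
pose p0 (u : induced P) : P := \sum_h gr_elt h *: u h.
have p0B : zmod_morphism p0.
  move=> u v; rewrite /p0 -sumrB; apply: eq_bigr => h _.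
  by rewrite !ffunE scalerBr.
have p0g g u : p0 (gr_elt g *: u) = gr_elt g *: p0 u.
  rewrite induced_actE /p0 scaler_sumr (reindex_inj (mulgI g)).
  by apply: eq_bigr => h _; rewrite ffunE mulgA mulVg mul1g gr_scaleME.
pose p : {linear induced P -> P} := HB.pack p0
  (GRing.isLinear.Build ZG _ _ _ _ (gr_linear p0B p0g)).
have [|s sE] := projP _ _ p (idfun : {linear P -> P}).
  move=> x; exists [ffun h => if h == 1%g then x else 0].
  rewrite /= /p0 (bigD1 1%g) //= big1 => [|h h1].
    by rewrite ffunE eqxx gr_elt1 scale1r addr0.
  by rewrite ffunE (negPf h1) scaler0.
have tB : zmod_morphism (fun x => s x 1%g).
  by move=> x y; rewrite linearB !ffunE.
pose theta : {additive P -> P} :=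
  HB.pack (fun x => s x 1%g) (GRing.isZmodMorphism.Build P P _ tB).
exists theta => x /=.
rewrite -[RHS]sE /= /p0; apply: eq_bigr => g _.
by rewrite linearZ /= induced_actE ffunE invgK mulg1.
Qed.

Lemma trivZE (x : Z) : x = one *~ (x : int).
Proof. by rewrite -[LHS](intz (x : int)). Qed.

Lemma linear_trivZE (V : lmodType ZG) (f : {linear Z -> V}) (x : Z) :
  f x = f one *~ (x : int).
Proof. by rewrite {1}(trivZE x) raddfMz. Qed.

Lemma linear_trivZ_inv (V : lmodType ZG) (f : {linear Z -> V}) g :
  gr_elt g *: f one = f one.
Proof. by rewrite -linearZ /= trivZ_actE. Qed.

Section TrivLin.
Variables (V : lmodType ZG) (v : V).
Hypothesis vG : forall g, gr_elt g *: v = v.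
Fact triv_lin_linear : linear (fun x : Z => v *~ (x : int)).
Proof.
apply: gr_linear => [x y|g x]; first exact: mulrzBr.
by rewrite trivZ_actE -scalerMzr vG.
Qed.
(** The map 1 |-> v out of the trivial module, for an invariant v. *)
Definition triv_lin : {linear Z -> V} := HB.pack (fun x : Z => v *~ (x : int))
  (GRing.isLinear.Build ZG _ _ _ _ triv_lin_linear).
End TrivLin.

Lemma projective_inv_norm (P : lmodType ZG) (x : P) : projective P ->
  (forall g, gr_elt g *: x = x) -> exists y, x = gr_norm gT *: y.
Proof.
move=> /projective_transfer[theta thE] xG; exists (theta x).
by rewrite gr_normE -{1}[x]thE; apply: eq_bigr => g _; rewrite xG.
Qed.

Lemma regular_projective : projective ZG^o.
Proof.
move=> A B p f pS; have [a ap] := pS (f 1).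
have aL : linear (fun x : ZG^o => x *: a) by move=> b x y; rewrite scalerDl scalerA.
pose f' : {linear ZG^o -> A} := HB.pack (fun x : ZG => x *: a)
  (GRing.isLinear.Build ZG ZG^o A _ _ aL).
exists f' => x.
by rewrite /= linearZ /= ap -linearZ /= -[x *: 1]/(x * 1) mulr1.
Qed.

(** Maps f and f' out of the trivial module are stably equal exactly when
    f(1) - f'(1) is a norm: an invariant element of a projective module is a
    norm, and a map 1 |-> N u factors through the group ring. *)
Lemma stable_class_eq (V : lmodType ZG) (f f' : {linear Z -> V}) :
  stable_class f = stable_class f' <->
  exists u, f one - f' one = gr_norm gT *: u.
Proof.
split=> [/eqP|[u uE]].
  rewrite /stable_class -Quotient.idealrBE => /asboolP[P [i [p [projP ip]]]].
  have [y yE] := projective_inv_norm projP (linear_trivZ_inv i).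
  by exists (p y); rewrite -linearZ -yE -ip.
apply/eqP; rewrite /stable_class -Quotient.idealrBE; apply/asboolP.
have nG g : gr_elt g *: (gr_norm gT : ZG^o) = gr_norm gT.
  rewrite -[gr_norm gT : ZG^o]mulr1.
  by rewrite -[gr_norm gT * 1]/(gr_norm gT *: (1 : ZG^o)) gr_norm_inv.
have uL : linear (fun x : ZG^o => x *: u) by move=> b x y; rewrite scalerDl scalerA.
pose p : {linear ZG^o -> V} := HB.pack (fun x : ZG^o => x *: u)
  (GRing.isLinear.Build ZG ZG^o V _ _ uL).
exists ZG^o, (triv_lin nG), p.
split; first exact: regular_projective.
move=> x; rewrite [LHS]linear_trivZE [RHS]/= -scalerMzl; congr (_ *~ _).
exact: uE.
Qed.

End GroupRingModules.

(** * Coinvariants and the norm *)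

Section TensorTrivial.
Local Open Scope quotient_scope.
Variable gT : finGroupType.
Local Notation ZG := (groupring gT).
Local Notation Z := (trivZ gT).
Local Notation one := (one_trivZ gT).
Implicit Types M N : lmodType ZG.

Lemma tens_piE M N (t u : {freeg (M * N)%type / int}) :
  (\pi_(tensor M N) t = \pi_(tensor M N) u) <-> zspan (@tensor_rel gT M N) (t - u).
Proof.
split=> [/eqP|h]; first by rewrite -Quotient.idealrBE => /asboolP.
by apply/eqP; rewrite -Quotient.idealrBE; apply/asboolP.
Qed.

Lemma zspan_gen (V : zmodType) (A : set V) x : A x -> zspan A x.
Proof. by move=> Ax S [_ SA]; exact: SA. Qed.

Lemma tens_pi_gen M N (t : {freeg (M * N)%type / int}) :
  @tensor_rel gT M N t -> \pi_(tensor M N) t = 0.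
Proof.
move=> rt; rewrite -(raddf0 (\pi_(tensor M N))).
by apply/tens_piE; rewrite subr0; exact: zspan_gen.
Qed.

Lemma tensDl M N (x x' : M) (y : N) : tens (x + x') y = tens x y + tens x' y.
Proof.
apply/eqP; rewrite -subr_eq0 opprD addrA /tens -!raddfB; apply/eqP.
by apply: tens_pi_gen; apply: Or31; exists x, x', y.
Qed.

Lemma tensDr M N (x : M) (y y' : N) : tens x (y + y') = tens x y + tens x y'.
Proof.
apply/eqP; rewrite -subr_eq0 opprD addrA /tens -!raddfB; apply/eqP.
by apply: tens_pi_gen; apply: Or32; exists x, y, y'.
Qed.

Lemma tens_balanced M N (a : ZG) (x : M) (y : N) :
  tens (gr_antipode a *: x) y = tens x (a *: y).
Proof.
apply/eqP; rewrite -subr_eq0 /tens -!raddfB; apply/eqP.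
by apply: tens_pi_gen; apply: Or33; exists a, x, y.
Qed.

Lemma gr_antipode_elt (g : gT) : gr_antipode (gr_elt g) = gr_elt g^-1%g.
Proof.
by apply/ffunP => h; rewrite !ffunE -(inj_eq invg_inj) invgK.
Qed.

Fact tensBl M N (y : N) : zmod_morphism (fun x : M => tens x y).
Proof. by move=> u v; apply/eqP; rewrite eq_sym subr_eq -tensDl subrK. Qed.
Fact tensBr M N (x : M) : zmod_morphism (fun y : N => tens x y).
Proof. by move=> u v; apply/eqP; rewrite eq_sym subr_eq -tensDr subrK. Qed.

(** x |-> x (x) 1, the projection of M to its coinvariants. *)
Definition tens1 M (x : M) : tensor M Z := tens x one.
HB.instance Definition _ M := GRing.isZmodMorphism.Build M (tensor M Z)
  (@tens1 M) (@tensBl M Z one).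

Lemma tens1_elt M g (x : M) : tens1 (gr_elt g *: x) = tens1 x.
Proof. by rewrite -[g]invgK -gr_antipode_elt /tens1 tens_balanced trivZ_actE. Qed.

Lemma tens1_map M M' (f : {linear M -> M'}) x : tens_map Z f (tens1 x) = tens1 (f x).
Proof. exact: tens_mapE. Qed.

Lemma tens1_surj M (t : tensor M Z) : exists x, t = tens1 x.
Proof.
rewrite -[t]reprK; elim/freeg_ind_dom0: (repr t) => [|k [x a] D _ _ [y yE]].
  by exists 0; rewrite !raddf0.
exists (x *~ (a : int) *~ k + y); apply: etrans (raddfD _ _ _) _.
apply: etrans _ (esym (raddfD (@tens1 M) _ _)); congr (_ + _); last exact: yE.
apply: etrans _ (esym (raddfMz (@tens1 M) k (x *~ (a : int)))).
have -> : << k *g (x, a) >> = << (x, a) >> *~ k :> {freeg (M * Z)%type / int}.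
  by rewrite freeg_mulz intz.
apply: etrans (raddfMz _ _ _) _; congr (_ *~ _).
pose f : {additive Z -> tensor M Z} := HB.pack (fun y : Z => tens x y)
  (GRing.isZmodMorphism.Build Z (tensor M Z) _ (@tensBr M Z x)).
apply: etrans _ (esym (raddfMz (@tens1 M) (a : int) x)).
by apply: etrans (congr1 f (trivZE a)) _; exact: raddfMz.
Qed.

Lemma gr_norm_antipode (b : ZG) :
  gr_norm gT * gr_antipode b = gr_norm gT *~ (\sum_g b g).
Proof.
have N1 g : gr_norm gT g = 1.
  rewrite sum_ffunE (bigD1 g) //= big1 => [|h hg]; first by rewrite ffunE eqxx addr0.
  by rewrite ffunE eq_sym (negPf hg).
apply/ffunP => x; rewrite ffunE groupring_mulrzE N1 intz.
rewrite [RHS](reindex_inj (mulgI x^-1%g)); apply: eq_bigr => g _.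
by rewrite N1 mul1r ffunE invMg invgK.
Qed.

Lemma trivZ_scaleE (b : ZG) (x : Z) : b *: x = x *~ (\sum_g b g).
Proof.
rewrite {1}(groupringE b) scaler_suml mulrz_sumr; apply: eq_bigr => g _.
by rewrite -scalerMzl trivZ_actE.
Qed.

(** The map x (x) 1 |-> N x is well defined on coinvariants. *)
Lemma tens1_norm M (x : M) : tens1 x = 0 -> gr_norm gT *: x = 0.
Proof.
pose Psi : {freeg (M * Z)%type / int} -> zmodule M :=
  fglift (fun p : M * Z => (gr_norm gT *: p.1) *~ (p.2 : int) : zmodule M).
have PsiB : zmod_morphism Psi by exact: lift_is_additive.
have PsiU p : Psi << p >> = (gr_norm gT *: p.1) *~ (p.2 : int) :> M.
  by rewrite /Psi liftU scale1r.
rewrite /tens1 /tens -(raddf0 (\pi_(tensor M Z))) => /tens_piE; rewrite subr0.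
move=> h; have: Psi << (x, one) >> = 0; last by move=> <-; rewrite PsiU.
apply: (h (fun t => Psi t = 0)); split=> [|t]; first split => [|u v /= u0 v0].
- by rewrite /= -(subrr 0) PsiB subrr.
- by rewrite PsiB u0 v0 subrr.
move=> [[u [u' [a ->]]]|[u [a [b ->]]]|[b [u [a ->]]]] /=; rewrite !PsiB !PsiU /=.
- apply/eqP; rewrite subr_eq0 subr_eq; apply/eqP.
  by rewrite scalerDr [LHS]mulrzDl addrC.
- apply/eqP; rewrite subr_eq0 subr_eq; apply/eqP.
  by rewrite [LHS]mulrzDr addrC.
apply/eqP; rewrite subr_eq0; apply/eqP.
rewrite scalerA gr_norm_antipode trivZ_scaleE -scalerMzl -mulrzA.
by congr (_ *~ _); rewrite mulrC; exact: esym (mulrzz _ _).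
Qed.

(** On a projective module this map is injective: x is the sum of the
    g theta(g^-1 x), which has the same image in the coinvariants as
    theta(N x). *)
Lemma norm_tens1 (P : lmodType ZG) (x : P) : projective P ->
  gr_norm gT *: x = 0 -> tens1 x = 0.
Proof.
move=> /projective_transfer[theta thE] Nx.
rewrite -[x]thE (raddf_sum (@tens1 P)).
transitivity (\sum_g tens1 (theta (gr_elt g^-1%g *: x))).
  by apply: eq_bigr => g _; rewrite /= tens1_elt.
rewrite -!raddf_sum (reindex_inj invg_inj) /=.
under eq_bigr do rewrite invgK.
by rewrite -gr_normE Nx !raddf0.
Qed.

End TensorTrivial.

(** * Homology classes *)

Section HomologyClasses.
Variables (A B C : zmodType) (f : {additive A -> B}) (g : {additive B -> C}).

Lemma homology_class_eq (c c' : zker g) :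
  homology_class f c = homology_class f c' <-> exists y, f y = val c - val c'.
Proof.
split=> [/eqP|[y yE]]; first by rewrite /homology_class -Quotient.idealrBE => /asboolP.
by apply/eqP; rewrite /homology_class -Quotient.idealrBE; apply/asboolP; exists y.
Qed.
End HomologyClasses.

Section Classes.
Variable gT : finGroupType.
Local Notation ZG := (groupring gT).
Local Notation Z := (trivZ gT).
Local Notation one := (one_trivZ gT).
Implicit Types (F P : aug_complex Z).

(** y (x) 1 is a cycle of homology class a.  Every class has such a
    representative, since x |-> x (x) 1 is onto. *)
Definition cycle_class P k (y : P k) (a : group_homology P k) : Prop :=
  has_class (tens1 y) a.

Lemma cycle_class_ex P k (a : group_homology P k) : exists y : P k, cycle_class y a.
Proof.
have [y yE] := tens1_surj (val (repr a)).
exists y, (repr a); split; first by rewrite -yE.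
by rewrite /homology_class reprK.
Qed.

Lemma cycle_class_total P k (y : P k.+1) : tens1 (cdiff P k y) = 0 ->
  exists a, cycle_class y a.
Proof.
move=> dy; have zy : zker_pred (cotensor_diff P k.+1) (tens1 y).
  by apply/eqP; rewrite /= tens1_map.
pose c : zker (cotensor_diff P k.+1) := exist _ (tens1 y) zy.
by exists (homology_class (cotensor_diff P k.+2) c), c.
Qed.

Lemma cycle_class_cycle P k (y : P k.+1) a : cycle_class y a -> tens1 (cdiff P k y) = 0.
Proof. by move=> [c [cE _]]; rewrite -tens1_map -cE; exact: (eqP (valP c)). Qed.

Lemma cycle_class_eq P k (y y' : P k) a a' : cycle_class y a -> cycle_class y' a' ->
  (a = a' <-> exists v, tens1 (y - y' - cdiff P k v) = 0).
Proof.
move=> [c [cE ->]] [c' [cE' ->]]; apply: iff_trans (homology_class_eq _ _ _) _.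
rewrite cE cE'; split=> [[t]|[v]].
  have [v ->] := tens1_surj t; rewrite /= tens1_map => e.
  by exists v; rewrite !raddfB /= e subrr.
move/eqP; rewrite !raddfB subr_eq0 => /eqP e.
by exists (tens1 v); rewrite e /= tens1_map.
Qed.

Lemma cycle_classB P k (y y' : P k) a a' : cycle_class y a -> cycle_class y' a' ->
  cycle_class (y - y') (a - a').
Proof.
move=> [c [cE ->]] [c' [cE' ->]]; exists (c - c'); split.
  by rewrite !raddfB /= cE cE'.
by rewrite /homology_class raddfB.
Qed.

End Classes.

(** * Representatives of classes and lifts of positive degree *)

Section Products.
Variable gT : finGroupType.
Local Notation ZG := (groupring gT).
Local Notation Z := (trivZ gT).
Local Notation one := (one_trivZ gT).
Local Notation N := (gr_norm gT).
Implicit Types (F P Q : aug_complex Z).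

Lemma cycle_class_tens1 P k (y y' : P k) (a : group_homology P k) :
  tens1 y = tens1 y' -> cycle_class y a -> cycle_class y' a.
Proof. by move=> e [c [cE ca]]; exists c; rewrite cE. Qed.

Lemma cycle_class_boundary P k (y : P k.+1) (v : P k.+2) a :
  cycle_class y a -> cycle_class (y + cdiff P k.+1 v) a.
Proof.
move=> ya; have [|a' ya'] := @cycle_class_total _ P k (y + cdiff P k.+1 v).
  by rewrite linearD /= cdiff_diff addr0; exact: cycle_class_cycle ya.
suff -> : a = a' by [].
apply/(cycle_class_eq ya ya'); exists (- v).
by rewrite (raddfN (cdiff P k.+1)) opprK opprD addrA subrK subrr raddf0.
Qed.

Lemma cycle_class_hom P k (y y' : P k.+1) (v : P k.+2) a :
  tens1 (y - y' - cdiff P k.+1 v) = 0 -> cycle_class y a <-> cycle_class y' a.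
Proof.
have aux (x x' : P k.+1) (u : P k.+2) : tens1 (x - x' - cdiff P k.+1 u) = 0 ->
    cycle_class x a -> cycle_class x' a.
  rewrite -addrA -opprD raddfB => /subr0_eq xx' xa.
  suff: cycle_class (x' + cdiff P k.+1 u) a.
    move=> /(cycle_class_boundary (- u)); rewrite (raddfN (cdiff P k.+1)).
    by rewrite addrK; exact: id.
  exact: cycle_class_tens1 xa.
move=> e; split; first exact: aux e.
apply: (aux _ _ (- v)).
rewrite (raddfN (cdiff P k.+1)) opprK -[RHS]oppr0 -e -raddfN; congr tens1.
by rewrite opprD opprB opprK.
Qed.

(** If s (x) 1 is a cycle, then N s is a cycle, because N d s depends only on
    d s (x) 1; so 1 |-> N s is a map into the syzygy.  This uses that the degree
    is positive: in degree 0 the augmentation of N s is not 0 in general. *)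
Lemma norm_hom_ex P k (s : P k.+1) : tens1 (cdiff P k s) = 0 ->
  exists f : {linear Z -> syzygy P k.+2}, syzygy_val (f one) = N *: s.
Proof.
move=> /tens1_norm ds.
have ks : kermod_pred (cboundary P k.+1) (N *: s) by apply/eqP; rewrite linearZ.
pose z : kermod (cboundary P k.+1) := exist _ (N *: s) ks.
have zG g : gr_elt g *: z = z by apply: val_inj; rewrite linearZ /= gr_norm_inv.
by exists (triv_lin zG).
Qed.

(** On an exact complex, the representative of a Tate class can be kept fixed in
    [tate_homology]: a stably trivial change of it moves y by a boundary. *)
Lemma tate_homologyP P k (f : {linear Z -> syzygy P k.+2}) (a : group_homology P k.+1) :
  exact_complex P ->
  tate_homology (stable_class f) a <->
  exists y : P k.+1, syzygy_val (f one) = N *: y /\ cycle_class y a.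
Proof.
move=> [_ eP]; split=> [[f' [y' [/stable_class_eq[u uE] f'y ya]]]|[y [fy ya]]].
  have [v vE] := eP _ _ (eqP (valP u)).
  exists (y' + cdiff P k.+1 v); split; last exact: cycle_class_boundary.
  rewrite vE scalerDr -f'y -[RHS]addrC -linearZ -uE.
  by rewrite /syzygy_val raddfB subrK.
by exists f, y.
Qed.

Lemma lifts0_boundary (B : lmodType ZG) F (T : aug_complex B)
    (chi : forall k, {linear F k -> T k}) n (y : F n.+1) :
  (forall k, projective (F k)) -> exact_complex T -> lifts (fun=> 0) chi ->
  tens1 (cdiff F n y) = 0 -> exists v, tens1 (chi n.+1 y - cdiff T n.+1 v) = 0.
Proof.
move=> pF eT chi0 dy; have [h hE] := lifts_null_homotopy pF eT chi0.
by exists (h n.+1 y); rewrite hE addrAC subrr add0r -tens1_map dy raddf0.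
Qed.

(** If chi lifts a map 1 |-> N (aug v), it is still zero on homology in positive
    degrees: subtracting the map x |-> aug(x) N v in degree 0 alone turns chi into
    a lift of 0. *)
Lemma lifts_norm_boundary (B : lmodType ZG) F (T : aug_complex B) (v : T 0)
    (chi : forall k, {linear F k -> T k}) n (y : F n.+1) :
  (forall k, projective (F k)) -> exact_complex T ->
  lifts (fun x : Z => (N *: caug T v) *~ (x : int)) chi ->
  tens1 (cdiff F n y) = 0 -> exists u, tens1 (chi n.+1 y - cdiff T n.+1 u) = 0.
Proof.
move=> pF eT [chi0 chiS] dy.
pose c := triv_lin (fun g => gr_norm_inv g v).
pose chi' k : {linear F k -> T k} :=
  if k is i.+1 then chi i.+1 else chi 0 \- (c \o caug F).
apply: (@lifts0_boundary B F T chi' n y) => //; split=> [x|[|k] x] /=.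
- by rewrite (linearB (caug T)) (raddfMz (caug T)) /= (linearZ_LR (caug T)) chi0 subrr.
- by rewrite chiS caug_diff mulr0z subr0.
- exact: chiS.
Qed.

(** Naturality of the maps of degree m + 1: phi lifts 1 |-> w on the pair (F, B),
    phi' lifts 1 |-> w' on the pair (P, B'), and the two pairs are compared by
    alpha and beta.  If beta w and w' differ by the norm of a boundary, and
    alpha y and y' have the same homology class, then so have beta (phi y) and
    phi' y'. *)
Theorem lifts_natural F P (B B' : aug_complex Z) m n
    (phi : forall k, {linear F k -> shift_complex B m k})
    (phi' : forall k, {linear P k -> shift_complex B' m k})
    (alpha : forall k, {linear F k -> P k}) (beta : forall k, {linear B k -> B' k})
    (w : B m) (w' : B' m) (v : B' m.+1) (y : F n.+1) (y' : P n.+1) (u : P n.+2) :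
  (forall k, projective (F k)) -> exact_complex B' ->
  lifts (fun x : Z => w *~ (x : int)) phi ->
  lifts (fun x : Z => w' *~ (x : int)) phi' ->
  chain_map alpha -> chain_map beta ->
  beta m w - w' = N *: cdiff B' m v ->
  tens1 (cdiff F n y) = 0 -> tens1 (alpha n.+1 y - y' - cdiff P n.+1 u) = 0 ->
  exists v', tens1 (beta (n.+1 + m.+1)%N (phi n.+1 y) - phi' n.+1 y'
                    - cdiff B' (n.+1 + m.+1) v') = 0.
Proof.
move=> pF eB' [phi0 phiS] [phi'0 phi'S] [al0 alS] [be0 beS] ww' dy yy'.
(* The hypotheses on phi and phi', with the terms of the shifted complexes seen
   as terms of B and B'. *)
have p0 x : cdiff B m (phi 0 x : B m.+1) = w *~ (caug F x : int) := phi0 x.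
have pS k x : cdiff B (k + m.+1) (phi k.+1 x : B (k + m.+1).+1) = phi k (cdiff F k x)
  := phiS k x.
have p'0 x : cdiff B' m (phi' 0 x : B' m.+1) = w' *~ (caug P x : int) := phi'0 x.
have p'S k x : cdiff B' (k + m.+1) (phi' k.+1 x : B' (k + m.+1).+1) = phi' k (cdiff P k x)
  := phi'S k x.
pose bphi k : {linear F k -> shift_complex B' m k} := beta (k + m.+1)%N \o phi k.
pose chi k : {linear F k -> shift_complex B' m k} := bphi k \- (phi' k \o alpha k).
have chiP : lifts (fun x : Z => (N *: caug (shift_complex B' m) v) *~ (x : int)) chi.
  split=> [x|k x].
    transitivity (beta m (cdiff B m (phi 0 x : B m.+1))
                  - cdiff B' m (phi' 0 (alpha 0 x) : B' m.+1)).
      by rewrite -beS; exact: linearB.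
    rewrite p0 p'0 al0 (raddfMz (beta m)) -mulrzBl; congr (_ *~ _); exact: ww'.
  transitivity (beta (k + m.+1)%N (cdiff B (k + m.+1) (phi k.+1 x : B (k + m.+1).+1))
     - cdiff B' (k + m.+1) (phi' k.+1 (alpha k.+1 x) : B' (k + m.+1).+1)).
    by rewrite -beS; exact: linearB.
  by rewrite pS p'S alS.
have aux (V : zmodType) (a b c d e : V) :
    a - b + (- d - e) = a - c - d + (c - b - e).
  by rewrite [a - c - d]addrAC -[c - b - e]addrA [RHS]addrA subrK addrACA.
have [v' v'E] := lifts_norm_boundary pF (shift_exact m eB') chiP dy.
(* The homotopy compares beta phi y with phi' alpha y; applying phi' to
   alpha y - y' - d u compares the latter with phi' y'. *)
pose x' : B' (n.+1 + m.+1)%N := phi' n.+1 (alpha n.+1 y - y' - cdiff P n.+1 u).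
have x'E : x' = phi' n.+1 (alpha n.+1 y) - phi' n.+1 y'
                - cdiff B' (n.+1 + m.+1) (phi' n.+2 u).
  by rewrite /x' !linearB /=; congr (_ - _); exact: (esym (p'S n.+1 u)).
have {yy'} x'0 : tens1 x' = 0.
  by rewrite -[x']/(phi' n.+1 _) -tens1_map yy' raddf0.
exists (v' + (phi' n.+2 u : B' (n.+1 + m.+1).+1)).
rewrite -[RHS](addr0 0) -{1}v'E -x'0 -raddfD; congr tens1; rewrite x'E.
rewrite (raddfD (cdiff B' (n.+1 + m.+1))) opprD.
rewrite -[chi n.+1 y]/(beta (n.+1 + m.+1)%N (phi n.+1 y) - phi' n.+1 (alpha n.+1 y)).
exact: aux.
Qed.

End Products.

(** * The product on homology *)

Section HomologyProduct.
Variable gT : finGroupType.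
Local Notation ZG := (groupring gT).
Local Notation Z := (trivZ gT).
Local Notation one := (one_trivZ gT).
Local Notation N := (gr_norm gT).
Implicit Types (F P Q : aug_complex Z).

(** The graph of the product on homology, computed without Tate groups: the
    classes of x (x) 1 and y (x) 1 are sent to that of phi x (x) 1, where phi is a
    map of degree m + 1 that lifts 1 |-> N y. *)
Definition homology_product F n m (a : group_homology F n) (b : group_homology F m)
    (c : group_homology F (n + m.+1)) : Prop :=
  exists (x : F n) (y : F m) (phi : forall k, {linear F k -> shift_complex F m k}),
    [/\ cycle_class x a, cycle_class y b,
        lifts (fun k : Z => (N *: y) *~ (k : int)) phi
      & cycle_class (phi n x : F (n + m.+1)%N) c].

Lemma chain_map_id F : chain_map (fun k => idfun : {linear F k -> F k}).
Proof. by []. Qed.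

Section Resolution.
Variable F : aug_complex Z.
Hypothesis resF : proj_resolution F.

Let projF k : projective (F k). Proof. by have [pF _ _ _] := resF. Qed.
Let exF : exact_complex F. Proof. by have [_ _ e0 eS] := resF. Qed.

Lemma norm_lift_ex m (y : F m.+1) : tens1 (cdiff F m y) = 0 ->
  exists phi : forall k, {linear F k -> shift_complex F m.+1 k},
    lifts (fun k : Z => (N *: y) *~ (k : int)) phi.
Proof.
move=> dy; pose g := triv_lin (fun h => gr_norm_inv h y).
have [|phi phiP] := lifts_ex projF (shift_exact m.+1 exF) (g := g); last by exists phi.
move=> x; have [_ eS] := exF; apply: (eS m).
apply: etrans (raddfMz (cdiff F m) _ _) _.
by rewrite /= linearZ /= tens1_norm // mul0rz.
Qed.

Lemma norm_lift_cycle m (y : F m.+1) n (x : F n.+1)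
    (phi : forall k, {linear F k -> shift_complex F m.+1 k}) :
  lifts (fun k : Z => (N *: y) *~ (k : int)) phi -> tens1 (cdiff F n x) = 0 ->
  tens1 (cdiff F (n + m.+2) (phi n.+1 x : F (n + m.+2).+1)) = 0.
Proof.
move=> [_ phiS] dx.
rewrite -[cdiff F _ _]/(cdiff (shift_complex F m.+1) n (phi n.+1 x)) phiS.
by rewrite -[LHS]tens1_map dx raddf0.
Qed.

Lemma homology_product_ex n m (a : group_homology F n.+1) (b : group_homology F m.+1)
    (x : F n.+1) (y : F m.+1) : cycle_class x a -> cycle_class y b ->
  exists (phi : forall k, {linear F k -> shift_complex F m.+1 k}) c,
    lifts (fun k : Z => (N *: y) *~ (k : int)) phi /\
    cycle_class (phi n.+1 x : F (n.+1 + m.+2)%N) c.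
Proof.
move=> xa yb; have [phi phiP] := norm_lift_ex (cycle_class_cycle yb).
have [c xc] := cycle_class_total (norm_lift_cycle phiP (cycle_class_cycle xa)).
by exists phi, c.
Qed.

Lemma homology_product_uniq n m (a : group_homology F n.+1) (b : group_homology F m.+1) c c' :
  homology_product a b c -> homology_product a b c' -> c = c'.
Proof.
move=> [x [y [phi [xa yb phiP xc]]]] [x' [y' [phi' [xa' yb' phi'P xc']]]].
have [u uE] := (cycle_class_eq xa xa').1 erefl.
have [v vE] := (cycle_class_eq yb yb').1 erefl.
have e : N *: y - N *: y' = N *: cdiff F m.+1 v.
  by apply/eqP; rewrite -subr_eq0 -!scalerBr; apply/eqP; exact: tens1_norm.
have [w wE] := lifts_natural (alpha := fun k => idfun) (beta := fun k => idfun)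
   projF exF phiP phi'P (@chain_map_id F) (@chain_map_id F) e (cycle_class_cycle xa) uE.
by apply/(cycle_class_eq xc xc'); exists w.
Qed.

(** The product transported from Tate cohomology is [homology_product]. *)
Lemma tate_productP n m (a : group_homology F n.+1) (b : group_homology F m.+1) c :
  tate_product a b c <-> homology_product a b c.
Proof.
split=> [[u [v [w [ua vb [f [g [h [uE vE [phi [phi0 phiS phih]] wE]]]] wc]]]]|].
  move: ua vb wc; rewrite uE vE wE => /(tate_homologyP _ _ exF)[x [fx xa]].
  move=> /(tate_homologyP _ _ exF)[y [gy yb]].
  move=> /(@tate_homologyP _ F (n + m.+2)%N _ _ exF)[z [hz zc]].
  exists x, y, phi; split=> //.
    split=> [t|k t]; last exact: phiS.
    by apply: etrans (phi0 t) _; rewrite linear_trivZE -gy /syzygy_val raddfMz.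
  move: hz; rewrite /= phih fx => hz.
  have hz' : N *: (phi n.+1 x : F (n.+1 + m.+2)%N) = N *: z.
    by rewrite -hz; exact: (esym (linearZ_LR (phi n.+1) N x)).
  (* N (phi x) = N z, so phi x and z agree in the coinvariants. *)
  apply: cycle_class_tens1 zc; apply/eqP; rewrite -subr_eq0 -raddfB; apply/eqP.
  by apply: norm_tens1; [exact: projF | rewrite scalerBr hz' subrr].
move=> [x [y [phi [xa yb [phi0 phiS] xc]]]].
have [f fx] := norm_hom_ex (cycle_class_cycle xa).
have [g gy] := norm_hom_ex (cycle_class_cycle yb).
have hk (t : kermod (cboundary F n.+1)) :
    kermod_pred (cboundary F (n.+1 + m.+2)) (phi n.+1 (val t)).
  apply/eqP; apply: etrans (phiS n (val t)) _.
  by rewrite (eqP (valP t)) linear0.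
pose h0 (t : syzygy F n.+2) : syzygy F (n.+2 + m.+2) :=
  (exist _ (phi n.+1 (val t) : F (n.+1 + m.+2)%N) (hk t)
     : kermod (cboundary F (n.+1 + m.+2))).
have h0L : linear h0 by move=> r s t; apply: val_inj; exact: (linearP (phi n.+1)).
pose h : {linear syzygy F n.+2 -> syzygy F (n.+2 + m.+2)} :=
  HB.pack h0 (GRing.isLinear.Build ZG _ _ _ _ h0L).
exists (stable_class f), (stable_class g), (stable_class (h \o f)); split.
- by apply/(tate_homologyP _ _ exF); exists x.
- by apply/(tate_homologyP _ _ exF); exists y.
- exists f, g, h; split=> //; exists phi; split=> // [t].
  by apply: etrans (phi0 t) _; rewrite linear_trivZE -gy /syzygy_val raddfMz.
apply/(@tate_homologyP _ F (n + m.+2)%N _ _ exF); exists (phi n.+1 x); split=> //.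
rewrite -[LHS]/(phi n.+1 (syzygy_val (f one))) fx.
exact: (linearZ_LR (phi n.+1) N x).
Qed.

Lemma homology_product_biadditive n m : exists mu : group_homology F n.+1 ->
    group_homology F m.+1 -> group_homology F (n.+1 + m.+2),
  biadditive mu /\ forall a b c, homology_product a b c <-> c = mu a b.
Proof.
have tot (a : group_homology F n.+1) (b : group_homology F m.+1) :
    exists c, homology_product a b c.
  have [x xa] := cycle_class_ex a; have [y yb] := cycle_class_ex b.
  have [phi [c [phiP xc]]] := homology_product_ex xa yb.
  by exists c, x, y, phi.
pose mu a b := sval (cid (tot a b)).
have muP a b : homology_product a b (mu a b) by exact: svalP (cid (tot a b)).
have muE a b c : homology_product a b c <-> c = mu a b.
  by split=> [h|->]; [exact: homology_product_uniq h _ | exact: muP].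
exists mu; split=> //; split=> [b a a'|a b b'].
- have [x xa] := cycle_class_ex a; have [x' xa'] := cycle_class_ex a'.
  have [y yb] := cycle_class_ex b.
  have [phi phiP] := norm_lift_ex (cycle_class_cycle yb).
  have [c xc] := cycle_class_total (norm_lift_cycle phiP (cycle_class_cycle xa)).
  have [c' xc'] := cycle_class_total (norm_lift_cycle phiP (cycle_class_cycle xa')).
  have <- : c = mu a b by apply/muE; exists x, y, phi.
  have <- : c' = mu a' b by apply/muE; exists x', y, phi.
  apply/esym/muE; exists (x - x'), y, phi; split => //; first exact: cycle_classB.
  rewrite (raddfB (phi n.+1)); exact: cycle_classB xc xc'.
- have [x xa] := cycle_class_ex a.
  have [y yb] := cycle_class_ex b; have [y' yb'] := cycle_class_ex b'.
  have [phi [c [phiP xc]]] := homology_product_ex xa yb.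
  have [phi' [c' [phi'P xc']]] := homology_product_ex xa yb'.
  have <- : c = mu a b by apply/muE; exists x, y, phi.
  have <- : c' = mu a b' by apply/muE; exists x, y', phi'.
  apply/esym/muE; exists x, (y - y'), (fun k => phi k \- phi' k); split => //.
  + exact: cycle_classB.
  + case: phiP phi'P => phi0 phiS [phi'0 phi'S]; split=> [t|k t] /=.
      rewrite scalerBr mulrzBl -phi0 -phi'0; exact: (raddfB (cdiff F m.+1)).
    by rewrite -phiS -phi'S; exact: (raddfB (cdiff F (k + m.+2))).
  + exact: cycle_classB xc xc'.
Qed.

End Resolution.

Section Representatives.
Variables (F P : aug_complex Z).
Hypotheses (resF : proj_resolution F) (exP : exact_complex P).

Let projF k : projective (F k). Proof. by have [pF _ _ _] := resF. Qed.

(** A class with representative s (x) 1 on F is represented by N chi(s), for any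
    chain map chi from F to P. *)
Lemma represents_ex n (a : group_homology F n.+1) :
  (forall t : Z, exists x, caug P x = t) ->
  exists z : P n.+1, inv_cycle P n.+1 z /\ represents P z a.
Proof.
move=> augP; have [s sa] := cycle_class_ex a.
have [chi [chi0 chiS]] := lifts_ex projF exP (g := idfun) (fun x => augP (caug F x)).
have dchi : tens1 (cdiff P n (chi n.+1 s)) = 0.
  by rewrite chiS -tens1_map (cycle_class_cycle sa) raddf0.
have [a' sa'] := cycle_class_total dchi.
have [f fE] := norm_hom_ex dchi.
exists (N *: chi n.+1 s); split.
  by split=> [g|]; [exact: gr_norm_inv | rewrite -fE; exact: (eqP (valP (f one)))].
exists f; split=> //; exists a'; split.
  by apply/(tate_homologyP _ _ exP); exists (chi n.+1 s).
exists chi; split=> //; exists (tens1 s); split=> //.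
by rewrite tens1_map.
Qed.

(** The data behind [represents], with a chain-level witness that the two
    homology classes agree. *)
Lemma representsP n (z : P n.+1) (a : group_homology F n.+1) : represents P z a ->
  exists (chi : forall k, {linear F k -> P k}) (s : F n.+1) (y : P n.+1) v,
    [/\ chain_map chi, cycle_class s a, z = N *: y, tens1 (cdiff P n y) = 0
      & tens1 (chi n.+1 s - y - cdiff P n.+1 v) = 0].
Proof.
move=> [f [fz [a' [/(tate_homologyP _ _ exP)[y [fy ya']]]]]].
move=> [chi [chiP [t [ta ta']]]]; have [s sE] := tens1_surj t; subst t.
have sa' : cycle_class (chi n.+1 s) a' by rewrite /cycle_class -tens1_map.
have [v vE] := (cycle_class_eq sa' ya').1 erefl.
exists chi, s, y, v; split=> //; first by rewrite -fz.
exact: cycle_class_cycle ya'.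
Qed.

(** The product of classes represented by z and w in P is represented by phi z in
    another complex Q, for any phi that lifts 1 |-> iota w, iota being a chain map
    from P to Q. *)
Theorem represents_product Q (iota : forall k, {linear P k -> Q k}) n m
    (a : group_homology F n.+1) (b : group_homology F m.+1) c
    (z : P n.+1) (w : P m.+1)
    (phi : forall k, {linear P k -> shift_complex Q m.+1 k}) :
  exact_complex Q -> chain_map iota ->
  lifts (fun k : Z => iota m.+1 w *~ (k : int)) phi ->
  homology_product a b c -> cdiff P n z = 0 ->
  represents P z a -> represents P w b ->
  inv_cycle Q (n.+1 + m.+2) (phi n.+1 z) /\
  represents Q (phi n.+1 z : Q (n.+1 + m.+2)%N) c.
Proof.
move=> exQ iotaP phiP abc dz.
move=> /representsP[chi [s [y [u [chiP sa zE dy yE]]]]].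
move=> /representsP[chi' [s' [y' [u' [chi'P sb wE dy' y'E]]]]].
have [psi [c' [psiP sc]]] := homology_product_ex resF sa sb.
have {abc} cE : c = c'.
  by apply: (homology_product_uniq resF) abc _; exists s, s', psi.
subst c'.
pose beta k : {linear F k -> Q k} := iota k \o chi' k.
have betaP : chain_map beta.
  case: iotaP chi'P => i0 iS [c0 cS]; split=> [x|k x] /=.
    by rewrite i0 c0.
  by rewrite iS cS.
have e : beta m.+1 (N *: s') - iota m.+1 w = N *: cdiff Q m.+1 (iota m.+2 u').
  have [_ iS] := iotaP.
  rewrite /beta /= wE -linearB (linearZ_LR (chi' m.+1)) -scalerBr linearZ /=.
  rewrite iS -!(linearZ_LR (iota m.+1)); congr (iota _ _); apply/eqP.
  by rewrite -subr_eq0 -scalerBr; apply/eqP; exact: tens1_norm.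
(* psi computes the product on F; naturality along chi on the source and along
   beta = iota chi' on the target compares it with phi. *)
have [v vE] := lifts_natural projF exQ psiP phiP chiP betaP e (cycle_class_cycle sa) yE.
have [phi0 phiS] := phiP.
have zN : phi n.+1 z = N *: (phi n.+1 y : Q (n.+1 + m.+2)%N).
  by rewrite zE; exact: (linearZ_LR (phi n.+1)).
split.
  split=> [g|]; first by rewrite zN gr_norm_inv.
  by apply: etrans (phiS n z) _; rewrite dz linear0.
have dphi : tens1 (cdiff Q (n + m.+2) (phi n.+1 y : Q (n + m.+2).+1)) = 0.
  rewrite -[cdiff Q _ _]/(cdiff (shift_complex Q m.+1) n (phi n.+1 y)) phiS.
  by rewrite -[LHS]tens1_map dy raddf0.
have [f fE] := norm_hom_ex dphi.
have [c' yc'] := cycle_class_total dphi.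
exists f; split; first by rewrite zN.
exists c'; split.
  apply/(@tate_homologyP _ Q (n + m.+2)%N _ _ exQ); by exists (phi n.+1 y).
exists beta; split=> //; exists (tens1 (psi n.+1 s : F (n.+1 + m.+2)%N)); split=> //.
rewrite tens1_map; exact: (cycle_class_hom c' vE).2.
Qed.

End Representatives.
End HomologyProduct.

(** * Contractibility of the join *)

Section JoinContractible.
Variable R : realType.
Local Open Scope classical_set_scope.
Local Open Scope quotient_scope.
Local Notation I := (unit_itv R).
Implicit Types X Y : topologicalType.

Fact itv_clamp_subproof (r : R) : Num.max 0 (Num.min 1 r) \in [set t : R | 0 <= t <= 1].
Proof. by apply/mem_set => /=; rewrite le_max lexx ge_max ler01 ge_min lexx. Qed.

(** The retraction of the real line onto the unit interval. *)
Definition itv_clamp (r : R) : I := exist _ (Num.max 0 (Num.min 1 r)) (itv_clamp_subproof r).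

Lemma itv_clamp_id (t : I) : itv_clamp (val t) = t.
Proof.
have /andP[t0 t1] := set_mem (valP t).
by apply: val_inj; rewrite /= (min_idPr t1) (max_idPr t0).
Qed.

Lemma itv_clamp_ge (r : R) : 1 <= r -> val (itv_clamp r) = 1.
Proof. by move=> r1; rewrite /= (min_idPl r1) (max_idPr ler01). Qed.

Lemma itv_clamp_le (r : R) : r <= 0 -> val (itv_clamp r) = 0.
Proof.
by move=> r0; rewrite /= (min_idPr (le_trans r0 ler01)) (max_idPl r0).
Qed.

Lemma itv_clamp_continuous (T : topologicalType) (f : T -> R) :
  continuous f -> continuous (fun x => itv_clamp (f x)).
Proof.
move=> fc; apply: continuous_set_type => x.
apply: (@continuous_max R T (fun=> 0) (fun x => Num.min 1 (f x)) x); first exact: cvg_cst.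
by apply: (@continuous_min R T (fun=> 1) f x); [exact: cvg_cst | exact: fc].
Qed.

Lemma compact_locally_compact (T : topologicalType) :
  compact [set: T] -> locally_compact [set: T].
Proof.
move=> cT x _; rewrite withinET; exists setT; first exact: filterT.
by split=> //; exact: closedT.
Qed.

Lemma unit_itv_hausdorff : hausdorff_space I.
Proof. by apply: hausdorff_set_type; exact: norm_hausdorff. Qed.

(** Although the product of a quotient map with a space is not a quotient map in
    general, continuity on the product of the join with I can be tested before
    passing to the quotient: I is compact Hausdorff, so currying turns H into a
    map from the join to the space of paths in Z with the compact-open
    topology. *)
Lemma join_homotopy_continuous X Y (Z : topologicalType) (H : join R X Y * I -> Z) :
  continuous (fun p : X * Y * I * I => H (join_pt p.1.1.1 p.1.1.2 p.1.2, p.2)) ->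
  continuous H.
Proof.
move=> Gc.
set G := (fun p : X * Y * I * I => _) in Gc.
have [cG1 cG2] := continuous_curry Gc.
have -> : H = uncurry (curry H) by apply/funext => -[].
apply: continuous_uncurry.
- by apply: compact_locally_compact; exact: unit_itv_compact.
- exact: unit_itv_hausdorff.
- apply: (@quotient_continuous _ {eq_quot @join_eq R X Y} {compact-open, I -> Z} (curry H)).2.
  rewrite (_ : _ \o _ = curry G) //.
  by apply/funext => -[[x y] t]; apply/funext => s.
- move=> q; have [x [y [t ->]]] := join_ptP q; exact: (cG2 (x, y, t)).
Qed.

(** The contraction moves (x, y, t) in two stages: for s <= 1/2 the point x is
    moved to x0 along h, with y and t fixed; then t is decreased to 0, where y is
    forgotten. *)
Theorem join_contractible X Y : contractible R X -> Y -> contractible R (join R X Y).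
Proof.
move=> [x0 [h [hc h0 h1]]] y0.
pose a (s : I) := itv_clamp (2 * val s).
pose w (t s : I) := itv_clamp (Num.min (val t) (2 - 2 * val s)).
pose H (q : join R X Y * I) : join R X Y :=
  let p := repr (q.1 : {eq_quot @join_eq R X Y}) in
  join_pt (h (p.1.1, a q.2)) p.1.2 (w p.2 q.2).
have sle (s : I) : 0 <= 2 - 2 * val s.
  have /andP[s0 s1] := set_mem (valP s).
  by rewrite subr_ge0 -[leRHS]mulr1 ler_pM2l.
have HE x y t s : H (join_pt x y t, s) = join_pt (h (x, a s)) y (w t s).
  rewrite /H /join_pt /=; case: piP => -[[x' y'] t'] /eqmodP/asboolP[/= <- ex ey].
  (* At t = 1 the dependence on x must vanish: either w is still 1, or the first
     stage is over and x has been moved to x0.  At t = 0, w is 0. *)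
  apply: join_pt_eq => // [wt|wt].
    have [t1|/eqP t1] := eqVneq (val t) 1; last by rewrite ex.
    suff a1 : val (a s) = 1 by rewrite !h1.
    apply: itv_clamp_ge; rewrite leNgt; apply/negP => s1; apply: wt.
    by apply: itv_clamp_ge; rewrite t1 le_min lexx /= lerBrDr -[leRHS]/(1 + 1) lerD2l ltW.
  rewrite ey // => t0; apply: wt; apply: itv_clamp_le.
  apply: (@le_trans _ _ (val t)); first by rewrite ge_min lexx.
  by rewrite [val t]t0.
exists (join_pt x0 y0 (itv0 R)), H; split.
- apply: join_homotopy_continuous.
  rewrite [X in continuous X](_ : _ = (fun p : X * Y * I * I =>
     \pi_(quotient_topology {eq_quot @join_eq R X Y})
       (h (p.1.1.1, a p.2), p.1.1.2, w p.1.2 p.2))); last first.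
    by apply/funext => -[[[x y] t] s]; exact: HE.
  have c1 : continuous (fun p : X * Y * I * I => p.1.1.1).
    apply: continuous_compo; last exact: continuous_fst.
    by apply: continuous_compo; [exact: continuous_fst | exact: continuous_fst].
  have c2 : continuous (fun p : X * Y * I * I => p.1.1.2).
    apply: continuous_compo; last exact: continuous_snd.
    by apply: continuous_compo; [exact: continuous_fst | exact: continuous_fst].
  have c3 : continuous (fun p : X * Y * I * I => val p.1.2).
    apply: continuous_compo; last exact: continuous_val.
    by apply: continuous_compo; [exact: continuous_fst | exact: continuous_snd].
  have c4 : continuous (fun p : X * Y * I * I => 2 * val p.2).
    move=> p; apply: (@cvgM R); first exact: cvg_cst.
    apply: (@continuous_compo _ _ _ (fun q : X * Y * I * I => q.2) (fun t : I => val t)).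
      exact: continuous_snd.
    exact: continuous_val.
  apply: (@continuous_compo _ _ _ (fun p : X * Y * I * I =>
    (h (p.1.1.1, a p.2), p.1.1.2, w p.1.2 p.2)) (\pi_(quotient_topology {eq_quot @join_eq R X Y})));
    last exact: pi_continuous.
  apply: continuous_pair; first apply: continuous_pair => //.
    apply: (@continuous_compo _ _ _ (fun p : X * Y * I * I => (p.1.1.1, a p.2)) h) => //.
    apply: continuous_pair => //; exact: itv_clamp_continuous.
  apply: itv_clamp_continuous => p; apply: (@continuous_min R _ _ _ p); first exact: c3.
  by apply: (@cvgB _ R^o); [exact: cvg_cst | exact: c4].
- move=> q t t0; have [x [y [u ->]]] := join_ptP q; rewrite HE.
  rewrite h0 /a ?t0 ?mulr0 ?itv_clamp_le //; congr (join_pt _ _ _).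
  rewrite /w t0 mulr0 subr0 -[RHS]itv_clamp_id; congr itv_clamp.
  have /andP[_ u1] := set_mem (valP u).
  by apply/min_idPl; apply: le_trans u1 _; rewrite ler1n.
move=> q t t1; have [x [y [u ->]]] := join_ptP q; rewrite HE.
have /andP[u0 _] := set_mem (valP u).
have w0 : w u t = itv0 R.
  apply: val_inj; rewrite /w t1 mulr1 subrr.
  by apply: itv_clamp_le; rewrite ge_min lexx orbT.
apply: join_pt_eq => // [_|]; last by rewrite w0.
by rewrite h1 // /a t1 mulr1; apply: itv_clamp_ge; rewrite ler1n.
Qed.

End JoinContractible.

(** * Faces of a join of simplices *)

Section Faces.
Variable R : realType.
Local Open Scope classical_set_scope.
Local Notation I := (unit_itv R).
Local Notation simplex := (simplex R).
Local Notation sing := (sing R).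
Local Notation join := (join R).
Local Notation face := (face R).
Implicit Types X Y : topologicalType.

Fact itv1_subproof : (1 : R) \in [set t : R | 0 <= t <= 1].
Proof. by apply/mem_set; rewrite /= lexx ler01. Qed.
Definition itv1 : I := exist _ 1 itv1_subproof.

Lemma simplex_map_id n (x : simplex n) : simplex_map id x = x.
Proof.
apply: val_inj; apply/rowP => l; rewrite mxE (bigD1 l) //= big1 ?addr0 // => k.
by case/andP => /eqP ->; rewrite eqxx.
Qed.

(** An affine map that preserves the first vertices and the last vertices is the
    join of its restrictions.  The implicit arguments of lshift and rshift are
    given because n.+1 + m.+1 and (n + m.+1).+1 are convertible, but not
    syntactically equal. *)
Lemma simplex_map_join n m n' m' (f1 : 'I_n'.+1 -> 'I_n.+1)
    (f2 : 'I_m'.+1 -> 'I_m.+1) (f : 'I_(n' + m'.+1).+1 -> 'I_(n + m.+1).+1)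
    (x : simplex n') (y : simplex m') (w : I) :
  (forall i, f (@lshift n'.+1 m'.+1 i) = @lshift n.+1 m.+1 (f1 i)) ->
  (forall j, f (@rshift n'.+1 m'.+1 j) = @rshift n.+1 m.+1 (f2 j)) ->
  simplex_map f (simplex_join x y w) =
  simplex_join (simplex_map f1 x) (simplex_map f2 y) w.
Proof.
move=> fl fr; apply: val_inj; apply/rowP => l; rewrite /= mxE.
rewrite (@big_split_ord _ _ _ n'.+1 m'.+1) /=.
under eq_bigr do rewrite simplex_join_rowl.
under [X in _ + X]eq_bigr do rewrite simplex_join_rowr.
rewrite -!mulr_sumr.
case: (@split_ordP n.+1 m.+1 l) => k ->.
- rewrite simplex_join_rowl mxE [X in _ + _ * X]big1 ?mulr0 ?addr0 => [|j].
    congr (_ * _); apply: eq_bigl => i.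
    by rewrite fl (inj_eq (@lshift_inj n.+1 m.+1)).
  by rewrite fr (@eq_rlshift n.+1 m.+1).
rewrite simplex_join_rowr mxE [X in _ * X + _]big1 ?mulr0 ?add0r => [|j].
  congr (_ * _); apply: eq_bigl => i.
  by rewrite fr (inj_eq (@rshift_inj n.+1 m.+1)).
by rewrite fl (@eq_lrshift n.+1 m.+1).
Qed.

(** An affine map with values in the last face of a join of simplices; the next
    lemma is about the first face. *)
Lemma simplex_map_join1 n m k (g : 'I_k.+1 -> 'I_m.+1) (f : 'I_k.+1 -> 'I_(n + m.+1).+1)
    (v : simplex n) (y : simplex k) :
  (forall j, f j = @rshift n.+1 m.+1 (g j)) ->
  simplex_map f y = simplex_join v (simplex_map g y) itv1.
Proof.
move=> fg; apply: val_inj; apply/rowP => l; rewrite /= mxE.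
case: (@split_ordP n.+1 m.+1 l) => i ->.
  by rewrite simplex_join_rowl subrr mul0r big1 // => j; rewrite fg (@eq_rlshift n.+1 m.+1).
rewrite simplex_join_rowr mul1r mxE; apply: eq_bigl => j.
by rewrite fg (inj_eq (@rshift_inj n.+1 m.+1)).
Qed.

Lemma simplex_map_join0 n m k (g : 'I_k.+1 -> 'I_n.+1) (f : 'I_k.+1 -> 'I_(n + m.+1).+1)
    (v : simplex m) (x : simplex k) :
  (forall j, f j = @lshift n.+1 m.+1 (g j)) ->
  simplex_map f x = simplex_join (simplex_map g x) v (itv0 R).
Proof.
move=> fg; apply: val_inj; apply/rowP => l; rewrite /= mxE.
case: (@split_ordP n.+1 m.+1 l) => i ->.
  rewrite simplex_join_rowl subr0 mul1r mxE; apply: eq_bigl => j.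
  by rewrite fg (inj_eq (@lshift_inj n.+1 m.+1)).
by rewrite simplex_join_rowr mul0r big1 // => j; rewrite fg (@eq_lrshift n.+1 m.+1).
Qed.

Section JoinFaces.
Variables X Y : topologicalType.

Lemma join_simplex_map n m n' m' (f1 : 'I_n'.+1 -> 'I_n.+1)
    (f2 : 'I_m'.+1 -> 'I_m.+1) (f : 'I_(n' + m'.+1).+1 -> 'I_(n + m.+1).+1)
    (s : sing X n) (t : sing Y m) p :
  (forall i, f (@lshift n'.+1 m'.+1 i) = @lshift n.+1 m.+1 (f1 i)) ->
  (forall j, f (@rshift n'.+1 m'.+1 j) = @rshift n.+1 m.+1 (f2 j)) ->
  join_simplex s t (simplex_map f p) =
  join_simplex (s \o simplex_map f1 : sing X n') (t \o simplex_map f2 : sing Y m') p.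
Proof.
move=> fl fr; rewrite -(simplex_joinK p) (simplex_map_join _ _ _ fl fr).
apply: etrans (join_simplex_funE s t _ _ _) _.
exact: esym (join_simplex_funE (s \o simplex_map f1 : sing X n')
  (t \o simplex_map f2 : sing Y m') _ _ _).
Qed.

(** For s of dimension 0, face 0 of s * t is t, and the others are the
    s * (face of t); if t has dimension 0 too, the last face is s. *)
Lemma join_simplex_face0 m (s : sing X 0) (t : sing Y m) p x :
  join_simplex s t (face (ord0 : 'I_(0 + m.+1).+1) p) = join_pt x (t p) itv1.
Proof.
have -> : face (ord0 : 'I_(0 + m.+1).+1) p =
      simplex_join (n := 0) (vertex R ord0) p itv1.
  rewrite -[p in RHS]simplex_map_id.
  apply: (@simplex_map_join1 0 m m id
    (fintype.lift (ord0 : 'I_(0 + m.+1).+1))) => j.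
  exact: val_inj.
apply: etrans (join_simplex_funE s t _ _ _) _.
exact: join_pt_eq.
Qed.

Lemma join_simplex_face_last (s : sing X 0) (t : sing Y 0) p y :
  join_simplex s t (face (ord_max : 'I_(0 + 1).+1) p) = join_pt (s p) y (itv0 R).
Proof.
have -> : face (ord_max : 'I_(0 + 1).+1) p =
      simplex_join (n := 0) p (vertex R (ord0 : 'I_1)) (itv0 R).
  rewrite -[p in RHS]simplex_map_id.
  apply: (@simplex_map_join0 0 0 0 id
    (fintype.lift (ord_max : 'I_(0 + 1).+1))) => j.
  by apply: val_inj; rewrite /= (ord1 j).
apply: etrans (join_simplex_funE s t _ _ _) _.
exact: join_pt_eq.
Qed.

Lemma join_simplex_face_lift m (s : sing X 0) (t : sing Y m.+1) (j : 'I_m.+2) :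
  (join_simplex s t \o face (fintype.lift ord0 j : 'I_(0 + m.+2).+1) : sing _ _) =
  join_simplex s (t \o face j : sing Y m).
Proof.
apply/continuousEP => p.
apply: etrans (@join_simplex_map 0 m.+1 0 m id (fintype.lift j)
  (fintype.lift (fintype.lift ord0 j : 'I_(0 + m.+2).+1)) s t p _ _) _.
- by move=> i; apply: val_inj; rewrite /= (ord1 i).
- move=> i; apply: val_inj; rewrite /= /bump; lia.
congr (@join_simplex R X Y 0 m _ _ p); apply/continuousEP => q /=.
by rewrite simplex_map_id.
Qed.

(** For s of positive dimension, the faces of s * t are the (face of s) * t and
    the s * (face of t). *)
Lemma join_simplex_face_left n m (s : sing X n.+1) (t : sing Y m) (i : 'I_n.+2) :
  (join_simplex s t \o face (@lshift n.+2 m.+1 i : 'I_(n + m.+1).+2) : sing _ _) =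
  join_simplex (s \o face i : sing X n) t.
Proof.
apply/continuousEP => p.
apply: etrans (@join_simplex_map n.+1 m n m (fintype.lift i) id
  (fintype.lift (@lshift n.+2 m.+1 i : 'I_(n + m.+1).+2)) s t p _ _) _.
- by move=> j; apply: val_inj.
- move=> j; apply: val_inj; have := ltn_ord i; rewrite /= /bump; lia.
congr (@join_simplex R X Y n m _ _ p); apply/continuousEP => q /=.
by rewrite simplex_map_id.
Qed.

Fact join_shift_subproof n m : (n + m.+2).+1 = (n.+1 + m.+1).+1.
Proof. by rewrite addnS. Qed.

(** s * t, reparametrized as a simplex of dimension n + m.+2, which is equal but
    not convertible to n.+1 + m.+1. *)
Definition join_shift n m (s : sing X n.+1) (t : sing Y m) : sing (join X Y) (n + m.+2) :=
  join_simplex s t \o simplex_map (cast_ord (join_shift_subproof n m)).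

Lemma join_simplex_face_right n m (s : sing X n.+1) (t : sing Y m.+1) (j : 'I_m.+2) :
  (join_simplex s t \o face (@rshift n.+2 m.+2 j : 'I_(n + m.+2).+2) : sing _ _) =
  join_shift s (t \o face j : sing Y m).
Proof.
apply/continuousEP => p; apply/esym.
pose f := fintype.lift (@rshift n.+2 m.+2 j : 'I_(n + m.+2).+2)
  \o cast_ord (esym (join_shift_subproof n m)).
transitivity (join_simplex (s \o simplex_map id : sing X n.+1) (t \o face j : sing Y m)
   (simplex_map (cast_ord (join_shift_subproof n m)) p)).
  congr (@join_simplex R X Y n.+1 m _ _ _); apply/continuousEP => q /=.
  by rewrite simplex_map_id.
apply: etrans (esym (@join_simplex_map n.+1 m.+1 n.+1 m id (fintype.lift j) f s t _ _ _)) _.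
- move=> i; apply: val_inj; have := ltn_ord i; rewrite /= /bump; lia.
- move=> i; apply: val_inj; rewrite /= /bump; lia.
rewrite simplex_map_comp; congr (join_simplex s t (simplex_map _ p)).
by apply/funext => i; rewrite /f /= cast_ordK.
Qed.
End JoinFaces.
End Faces.

(** * Exactness of the singular complex of a contractible space *)

Section Acyclic.
Variables (R : realType) (gT : finGroupType).
Local Open Scope classical_set_scope.
Local Open Scope quotient_scope.
Local Notation I := (unit_itv R).
Local Notation simplex := (simplex R).
Local Notation sing := (sing R).
Local Notation join := (join R).
Local Notation face := (face R).
Local Notation chain := (chain R).

Definition const_simplex (X : topologicalType) n (x : X) : sing X n :=
  mkcts (@cst_continuous (simplex n) X x).

Section Cone.
Variables (X : gspace gT) (x0 : X) (h : X * I -> X).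
Hypotheses (hc : continuous h) (h0 : forall x t, val t = 0 -> h (x, t) = x)
  (h1 : forall x t, val t = 1 -> h (x, t) = x0).

(** The map from the join X * X to X given by (x, y, t) |-> h (y, 1 - t), which
    does not depend on x: it maps the second factor identically, and the first
    one to x0. *)
Definition cone_map (q : join X X) : X :=
  let p := repr (q : {eq_quot @join_eq R X X}) in
  h (p.1.2, itv_clamp (1 - val p.2)).

Lemma cone_mapE x y t : cone_map (join_pt x y t) = h (y, itv_clamp (1 - val t)).
Proof.
rewrite /cone_map /join_pt; case: piP => -[[x' y'] t'] /eqmodP/asboolP[/= <- ex ey].
have [t0|/eqP t0] := eqVneq (val t) 0; last by rewrite ey.
have c1 : val (itv_clamp (1 - val t)) = 1 by apply: itv_clamp_ge; rewrite t0 subr0.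
by rewrite !h1.
Qed.

Lemma cone_map_continuous : continuous cone_map.
Proof.
apply: (@quotient_continuous _ {eq_quot @join_eq R X X} X cone_map).2.
rewrite (_ : _ \o _ = fun p : X * X * I => h (p.1.2, itv_clamp (1 - val p.2))).
  apply: (@continuous_compo _ _ _ (fun p : X * X * I => (p.1.2, itv_clamp (1 - val p.2))) h) => //.
  apply: continuous_pair.
    by apply: continuous_compo; [exact: continuous_fst | exact: continuous_snd].
  apply: itv_clamp_continuous => p; apply: (@cvgB _ R^o); first exact: cvg_cst.
  apply: (@continuous_compo _ _ _ (fun q : X * X * I => q.2) (fun t : I => val t)).
    exact: continuous_snd.
  exact: continuous_val.
by apply/funext => -[[x y] t]; exact: cone_mapE.
Qed.

(** The cone on s with apex x0 (the new vertex comes first), as the image of the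
    join of a point with s. *)
Definition cone_simplex n (s : sing X n) : sing X n.+1 :=
  mkcts cone_map_continuous \o join_simplex (const_simplex 0 x0) s.

Definition cone_chain n : chain X n -> chain X n.+1 := free_map (@cone_simplex n).
HB.instance Definition _ n := GRing.isZmodMorphism.Build (chain X n) (chain X n.+1)
  (@cone_chain n) (free_map_is_zmod_morphism (@cone_simplex n)).

Lemma cone_chainU n k (s : sing X n) :
  cone_chain << k *g s >> = << k *g cone_simplex s >>.
Proof. exact: free_mapU. Qed.

Lemma cone_simplex_face0 n (s : sing X n) : (cone_simplex s \o face ord0 : sing X n) = s.
Proof.
apply/continuousEP => p.
apply: etrans (congr1 cone_map (join_simplex_face0 (const_simplex 0 x0) s p x0)) _.
rewrite cone_mapE; apply: h0; apply: itv_clamp_le.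
by rewrite /= subrr.
Qed.

Lemma cone_simplex_face_lift n (s : sing X n.+1) j :
  (cone_simplex s \o face (fintype.lift ord0 j) : sing X n.+1) =
  cone_simplex (s \o face j : sing X n).
Proof.
apply/continuousEP => p.
have /continuousEP/(_ p) e := join_simplex_face_lift (const_simplex 0 x0) s j.
exact: (congr1 cone_map e).
Qed.

Lemma cone_simplex_face_last (s : sing X 0) :
  (cone_simplex s \o face ord_max : sing X 0) = const_simplex 0 x0.
Proof.
apply/continuousEP => p.
apply: etrans (congr1 cone_map (join_simplex_face_last (const_simplex 0 x0) s p x0)) _.
rewrite cone_mapE; apply: h1; apply: itv_clamp_ge.
by rewrite /= subr0.
Qed.

Lemma cone_chain_boundary n (x : chain X n.+1) :
  chain_boundary (cone_chain x) = x - cone_chain (chain_boundary x).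
Proof.
move: x; apply: (@freeg_ext (sing X n.+1) (chain X n.+1)
  (fun x => chain_boundary (cone_chain x)) (fun x => x - cone_chain (chain_boundary x))).
- by move=> x y; rewrite !raddfB.
- by move=> x y; rewrite !raddfB /=; exact: addrACA.
move=> s; rewrite cone_chainU !chain_boundaryU /sing_boundary.
rewrite big_ord_recl expr0 cone_simplex_face0; congr (_ + _).
rewrite raddf_sum -sumrN; apply: eq_bigr => j _ /=.
by rewrite cone_simplex_face_lift cone_chainU freegUN /bump leq0n add1n exprS mulN1r.
Qed.

Lemma cone_chain_boundary0 (x : chain X 0) :
  chain_boundary (cone_chain x) =
  x - << const_simplex 0 x0 >> *~ (chain_augmentation x : int).
Proof.
move: x; apply: (@freeg_ext (sing X 0) (chain X 0)
  (fun x => chain_boundary (cone_chain x))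
  (fun x => x - << const_simplex 0 x0 >> *~ (chain_augmentation x : int))).
- by move=> x y; rewrite !raddfB.
- move=> x y; rewrite (raddfB (@chain_augmentation R gT X)) mulrzBr !opprD.
  exact: addrACA.
move=> s; rewrite cone_chainU !chain_boundaryU /sing_boundary.
rewrite !big_ord_recl big_ord0 expr0 cone_simplex_face0 addr0; congr (_ + _).
rewrite chain_augmentationU mulr1z freegUN lift0 expr1.
by rewrite -(cone_simplex_face_last s); do 3 congr (_ _); apply: val_inj.
Qed.

End Cone.

(** The cone operator is a contracting homotopy of the augmented complex. *)
Lemma singular_exact (X : gspace gT) : contractible R X ->
  (forall k, exists x, caug (singular_complex R X) x = k) /\
  exact_complex (singular_complex R X).
Proof.
move=> [x0 [h [hc h0 h1]]]; split=> [k|].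
  exists (<< const_simplex 0 x0 >> *~ (k : int)).
  rewrite raddfMz [RHS]trivZE; congr (_ *~ _); exact: chain_augmentationU.
split=> [x /= x_0|k x /= dx].
  by exists (cone_chain hc h1 x); rewrite /= cone_chain_boundary0 // x_0 mulr0z subr0.
by exists (cone_chain hc h1 x); rewrite /= cone_chain_boundary // dx raddf0 subr0.
Qed.

End Acyclic.

(** * Joins of chains *)

Section JoinChains.
Variables (R : realType) (gT : finGroupType).
Local Open Scope classical_set_scope.
Local Open Scope quotient_scope.
Local Notation sing := (sing R).
Local Notation chain := (chain R).
Variables (X Y : gspace gT).
Local Notation J := (join_gspace R X Y).

Section RightInclusion.
Variable x0 : X.

(** The inclusion of Y in the join X * Y.  At t = 1 the first coordinate is
    irrelevant; any point x0 of X serves to write it. *)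
Definition join_inr (y : Y) : J := join_pt x0 y (itv1 R).

Lemma join_inr_continuous : continuous join_inr.
Proof.
apply: (@continuous_compo _ _ _ (fun y : Y => (x0, y, itv1 R))
  (\pi_(quotient_topology {eq_quot @join_eq R X Y}))); last exact: pi_continuous.
apply: continuous_pair; last by move=> y; exact: cvg_cst.
by apply: continuous_pair; [move=> y; exact: cvg_cst | move=> y; exact: cvg_id].
Qed.

Lemma join_inr_act g y : join_inr (Defs.gact g y) = Defs.gact g (join_inr y).
Proof.
by apply: esym; apply: etrans (join_actE _ _ _ _) _; exact: join_pt_eq.
Qed.

Definition sing_inr n (t : sing Y n) : sing J n := mkcts join_inr_continuous \o t.

Definition chain_inr n : chain Y n -> chain J n := free_map (@sing_inr n).

Lemma chain_inrU n k (t : sing Y n) : chain_inr << k *g t >> = << k *g sing_inr t >>.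
Proof. exact: free_mapU. Qed.

Fact chain_inr_linear n : linear (@chain_inr n).
Proof.
apply: equivariant_linear => [|g t]; first exact: free_map_is_zmod_morphism.
rewrite !chain_inrU chain_actE chain_actU; congr << _ *g _ >>.
by apply/continuousEP => p; exact: join_inr_act.
Qed.
HB.instance Definition _ n := GRing.isLinear.Build (groupring gT) (chain Y n)
  (chain J n) _ (@chain_inr n) (@chain_inr_linear n).

Lemma chain_inr_chain_map : chain_map (P := singular_complex R Y)
  (Q := singular_complex R J) (fun n => (@chain_inr n : {linear chain Y n -> chain J n})).
Proof.
split=> [|n]; apply: freeg_ext.
- by move=> x y /=; rewrite !raddfB.
- by move=> x y /=; rewrite !raddfB.
- move=> s /=; rewrite chain_inrU.
  by apply: etrans (chain_augmentationU _ _) (esym (chain_augmentationU _ _)).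
- by move=> x y /=; rewrite !raddfB.
- by move=> x y /=; rewrite !raddfB.
move=> s /=; rewrite chain_inrU !chain_boundaryU /sing_boundary raddf_sum /=.
apply: eq_bigr => i _; rewrite chain_inrU; congr << _ *g _ >>.
exact/continuousEP.
Qed.
End RightInclusion.

Lemma join_chainB n m (w : chain Y m) :
  zmod_morphism (fun z : chain X n => join_chain z w : chain J (n + m.+1)).
Proof. exact: lift_is_additive. Qed.

Lemma join_chainE n m (s : sing X n) (w : chain Y m) :
  join_chain << s >> w = free_map (join_simplex s) w.
Proof. by rewrite /join_chain liftU scale1r. Qed.

Lemma join_chainU n m k (s : sing X n) (t : sing Y m) :
  join_chain << k *g s >> << t >> = << k *g join_simplex s t >>.
Proof.
rewrite /join_chain !liftU scale1r; apply/eqP/freeg_eqP => z.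
by rewrite coeffZ !coeffU mul1r.
Qed.

Lemma join_chainBr n m (z : chain X n) :
  zmod_morphism (fun w : chain Y m => join_chain z w : chain J (n + m.+1)).
Proof.
move=> x y; move: z; apply: (@freeg_ext (sing X n) (chain J (n + m.+1))
  (fun z => join_chain z (x - y)) (fun z => join_chain z x - join_chain z y)).
- by move=> u v; rewrite join_chainB.
- by move=> u v; rewrite !join_chainB !opprD; exact: addrACA.
by move=> s; rewrite !join_chainE raddfB.
Qed.

Lemma join_chain_act n m g (s : sing X n) (w : chain Y m) :
  join_chain << sing_act g s >> (chain_act g w) =
  chain_act g (join_chain << s >> w : chain J (n + m.+1)).
Proof.
rewrite !join_chainE; move: w; apply: (@freeg_ext (sing Y m) (chain J (n + m.+1))
  (fun w => free_map (join_simplex (sing_act g s)) (chain_act g w))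
  (fun w => chain_act g (free_map (join_simplex s) w : chain J (n + m.+1)))).
- by move=> x y; rewrite !raddfB.
- by move=> x y; rewrite !raddfB.
move=> t; rewrite chain_actU !free_mapU chain_actU; congr << _ *g _ >>.
apply/continuousEP => p; exact: esym (join_actE _ _ _ _).
Qed.

Lemma join_chain_linear n m (w : chain Y m) : (forall g, gr_elt g *: w = w) ->
  linear (fun z : chain X n => join_chain z w : chain J (n + m.+1)).
Proof.
move=> wG; apply: equivariant_linear => [|g s]; first exact: join_chainB.
by rewrite chain_actE -join_chain_act -chain_actE wG.
Qed.

Lemma join_chain_boundary0 m x0 (s : sing X 0) (w : chain Y m.+1) :
  chain_boundary (join_chain << s >> w : chain J m.+2) =
  chain_inr x0 w - (free_map (join_simplex s) (chain_boundary w) : chain J m.+1).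
Proof.
rewrite join_chainE; move: w; apply: (@freeg_ext (sing Y m.+1) (chain J m.+1)
  (fun w => chain_boundary (free_map (join_simplex s) w : chain J m.+2))
  (fun w => chain_inr x0 w - (free_map (join_simplex s) (chain_boundary w) : chain J m.+1))).
- by move=> x y; rewrite !raddfB.
- by move=> x y; rewrite !raddfB /=; exact: addrACA.
move=> t; rewrite chain_inrU free_mapU !chain_boundaryU /sing_boundary.
rewrite big_ord_recl expr0; congr (_ + _).
  congr << _ *g _ >>; apply/continuousEP => p; exact: join_simplex_face0.
rewrite raddf_sum -sumrN; apply: eq_bigr => j _ /=.
by rewrite free_mapU freegUN join_simplex_face_lift /bump leq0n add1n exprS mulN1r.
Qed.

(** The boundary formula d (s * w) = d s * w + (-1)^n s * d w for s of
    dimension n + 1; the last join is the reparametrized one. *)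
Lemma join_chain_boundaryS n m (s : sing X n.+1) (w : chain Y m.+1) :
  chain_boundary (join_chain << s >> w : chain J (n + m.+2).+1) =
  join_chain (sing_boundary s) w +
  (free_map (join_shift s) (chain_boundary w) : chain J (n + m.+2)) *~ (-1) ^+ n.
Proof.
move: w; apply: (@freeg_ext (sing Y m.+1) (chain J (n + m.+2))
  (fun w => chain_boundary (join_chain << s >> w : chain J (n + m.+2).+1))
  (fun w => join_chain (sing_boundary s) w +
    (free_map (join_shift s) (chain_boundary w) : chain J (n + m.+2)) *~ (-1) ^+ n)).
- by move=> x y; rewrite !join_chainE !raddfB.
- move=> x y; rewrite join_chainBr !raddfB /= mulrzBl opprD; exact: addrACA.
move=> t; rewrite join_chainU !chain_boundaryU /sing_boundary.
rewrite (@big_split_ord _ _ _ n.+2 m.+2) /=; congr (_ + _).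
  pose f : {additive chain X n -> chain J (n + m.+2)} :=
    HB.pack (fun z : chain X n => join_chain z << t >> : chain J (n + m.+2))
    (GRing.isZmodMorphism.Build _ _ _ (@join_chainB n m.+1 << t >>)).
  rewrite -[RHS]/(f _) raddf_sum; apply: eq_bigr => i _.
  by rewrite [RHS]join_chainU join_simplex_face_left.
rewrite raddf_sum mulrz_suml; apply: eq_bigr => j _ /=.
rewrite free_mapU join_simplex_face_right freeg_mulz; congr << _ *g _ >>.
by rewrite mulrzz -exprD addnC !addnS !exprS !mulN1r opprK.
Qed.

Section JoinLift.
Variables (x0 : X) (m : nat) (w : chain Y m.+1).
Hypotheses (wG : forall g, gr_elt g *: w = w) (dw : chain_boundary w = 0).

(** z |-> z * w, for a fixed invariant cycle w, as a map of degree m + 2 from the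
    singular complex of X to that of the join. *)
Definition join_lift n : {linear chain X n -> chain J (n + m.+2)} :=
  HB.pack (fun z : chain X n => join_chain z w : chain J (n + m.+2))
    (GRing.isLinear.Build (groupring gT) _ _ _ _ (join_chain_linear (n := n) wG)).

Lemma join_lift_lifts : lifts (fun k : trivZ gT => chain_inr x0 w *~ (k : int))
  (P := singular_complex R X) (Q := shift_complex (singular_complex R J) m.+1)
  join_lift.
Proof.
split=> [|n].
  apply: (@freeg_ext (sing X 0) (chain J m.+1)
    (fun z => chain_boundary (join_chain z w : chain J m.+2))
    (fun z => chain_inr x0 w *~ (chain_augmentation z : int))).
  - by move=> x y; rewrite (@join_chainB 0 m.+1) raddfB.
  - by move=> x y; rewrite (raddfB (@chain_augmentation R gT X)) mulrzBr.
  move=> s; rewrite (join_chain_boundary0 x0) dw raddf0 subr0 chain_augmentationU.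
  by rewrite mulr1z.
apply: (@freeg_ext (sing X n.+1) (chain J (n + m.+2))
  (fun z => chain_boundary (join_chain z w : chain J (n + m.+2).+1))
  (fun z => join_chain (chain_boundary z) w)).
- by move=> x y; rewrite (@join_chainB n.+1 m.+1) raddfB.
- by move=> x y; rewrite raddfB (@join_chainB n m.+1).
move=> s; rewrite join_chain_boundaryS dw raddf0 chain_boundaryU.
by rewrite mul0rz addr0.
Qed.
End JoinLift.

End JoinChains.

Theorem theorem11 (R : realType) (gT : finGroupType)
    (F : aug_complex (trivZ gT)) (EG : gspace gT) (cw : gcw_structure R EG)
    (n m : nat) :
  proj_resolution F ->
  contractible R EG ->
  free_action EG ->
  (0 < n)%N -> (0 < m)%N ->
  exists mu : group_homology F n -> group_homology F m ->
              group_homology F (n + m.+1),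
    [/\ biadditive mu,
        forall a b c, tate_product a b c <-> c = mu a b,
        forall a : group_homology F n, exists z : chain R EG n,
          inv_cycle (singular_complex R EG) n z /\
          represents (singular_complex R EG) z a
      & forall (a : group_homology F n) (b : group_homology F m)
               (z : chain R EG n) (w : chain R EG m),
          inv_cycle (singular_complex R EG) n z ->
          inv_cycle (singular_complex R EG) m w ->
          represents (singular_complex R EG) z a ->
          represents (singular_complex R EG) w b ->
          inv_cycle (singular_complex R (join_gspace R EG EG)) (n + m.+1)
            (join_chain z w) /\
          represents (singular_complex R (join_gspace R EG EG))
            (join_chain z w) (mu a b)].
Proof.
move=> resF cEG _; case: n => // n _; case: m => // m _.
have [mu [muB muP]] := homology_product_biadditive resF n m.
have [augEG exEG] := singular_exact cEG.
have [x0 _] := cEG.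
have [_ exJ] := singular_exact (X := join_gspace R EG EG) (join_contractible cEG x0).
exists mu; split=> // [a b c|a|a b z w [zG dz] [wG dw] za wb].
- by rewrite -muP; exact: tate_productP.
- exact: (represents_ex resF exEG a augEG).
by have [] := represents_product resF exEG exJ
  (@chain_inr_chain_map R gT EG EG x0) (join_lift_lifts x0 wG dw)
  ((muP a b _).2 erefl) dz za wb.
Qed.
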